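(* Let $n,m\geq1$ with $nm>2$. For every sequence of balls $\Psi=(B_q)_{q\in\mathbb{N}}$ in $\mathbb{R}^m/\mathbb{Z}^m$, \[ |\mathcal{A}_{n,m}(\Psi)|=\begin{cases}0 & \text{if } \sum_{q=1}^\infty q^{n-1}|B_q|<\infty,\\ 1 & \text{if } \sum_{q=1}^\infty q^{n-1}|B_q|=\infty.\end{cases} \]
   Context: For $\mathbf{q}\in\mathbb{Z}^n$, $|\mathbf{q}|=\max_i|q_i|$. Points $\mathbf{x}\in[0,1]^{nm}$ are $n\times m$ matrices and $\mathbf{q}\mathbf{x}\in\mathbb{R}^m$ is the row-vector–matrix product. Balls are max-norm balls in the torus $\mathbb{R}^m/\mathbb{Z}^m$; $|\cdot|$ is Lebesgue measure. $\mathcal{A}_{n,m}(\Psi)$ is the set of $\mathbf{x}\in[0,1]^{nm}$ such that $\mathbf{q}\mathbf{x}+\mathbf{p}\in B_{|\mathbf{q}|}$ (modulo $\mathbb{Z}^m$) for infinitely many pairs $(\mathbf{p},\mathbf{q})\in\mathbb{Z}^m\times(\mathbb{Z}^n\setminus\{\mathbf 0\})$. *)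

(* Defs.v *)
From HB Require Import structures.
From mathcomp Require Import all_boot all_order all_algebra.
From mathcomp Require Import all_classical all_reals all_analysis.
Set Implicit Arguments. Unset Strict Implicit. Unset Printing Implicit Defensive.
Import Order.TTheory GRing.Theory Num.Theory.
Local Open Scope classical_set_scope.
Local Open Scope ring_scope.

Section Defs.
Variable R : realType.

Definition mxbox (n m : nat) (a b : 'M[R]_(n, m)) : set 'M[R]_(n, m) :=
  [set x | forall i j, a i j <= x i j <= b i j].

Definition mxbox_vol (n m : nat) (a b : 'M[R]_(n, m)) : R :=
  \prod_(i < n) \prod_(j < m) (b i j - a i j).

Definition leb_outer (n m : nat) (A : set 'M[R]_(n, m)) : \bar R :=
  ereal_inf [set s | exists a b : nat -> 'M[R]_(n, m),
    [/\ (forall k i j, a k i j <= b k i j),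
        A `<=` \bigcup_k mxbox (a k) (b k) &
        s = (\sum_(0 <= k <oo) (mxbox_vol (a k) (b k))%:E)%E]].

Definition unit_cube (n m : nat) : set 'M[R]_(n, m) :=
  [set x | forall i j, 0 <= x i j <= 1].

Definition supnorm (n : nat) (q : 'rV[int]_n) : nat :=
  \max_(i < n) `|q ord0 i|%N.

(* The max-norm open ball of centre c and radius r in R^m, lifted from the
   torus: y lies in it iff max_j |y_j - c_j| < r. *)
Definition Rball (m : nat) (c : 'rV[R]_m) (r : R) : set 'rV[R]_m :=
  [set y | forall j, `|y ord0 j - c ord0 j| < r].

Definition torus_ball_measure (m : nat) (r : R) : R :=
  Num.min 1 ((2 * r) ^+ m).

(* A_{n,m}(Psi): x in [0,1]^{nm} such that qx + p lies in B_{|q|} for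
   infinitely many (p,q) with q <> 0, read as: infinitely many q <> 0 for
   which qx lies in B_{|q|} modulo Z^m. *)
Definition A_set (n m : nat) (c : nat -> 'rV[R]_m) (r : nat -> R)
  : set 'M[R]_(n, m) :=
  [set x | unit_cube x /\
     infinite_set [set q : 'rV[int]_n | q != 0 /\
        exists p : 'rV[int]_m,
          Rball (c (supnorm q)) (r (supnorm q))
                ((map_mx intr q) *m x + map_mx intr p)]].

End Defs.

(* Main.v *)
Require Import Defs.
From HB Require Import structures.
From mathcomp Require Import all_boot all_order all_algebra.
From mathcomp Require Import all_classical all_reals all_analysis.
From mathcomp Require Import zify ring lra.
Set Implicit Arguments. Unset Strict Implicit. Unset Printing Implicit Defensive.
Import Order.TTheory GRing.Theory Num.Theory.
Import numFieldNormedType.Exports.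
Local Open Scope ring_scope.

(* The torus is discretised: for a prime P, the n x m matrices over Z / P stand
   for the points of the grid of step 1 / P in the unit cube, and linear algebra
   modulo P replaces Haar measure.

   Divergence.  Only the vectors q = (Q, u) with 1 <= u_i <= Q are used, which
   are Q^(n-1) many for each Q.  The events "q x is in the ball B_Q" of two such
   vectors are quasi-independent when the vectors are not proportional.  For
   q = s v and q' = e v with s <= e coprime, the measure of the intersection
   exceeds this bound by at most (rho' / e)^m up to a constant; since q' must be
   divisible by e, the sum of these excesses is at most the sum of 1 / e^(n+m-2)
   over e times the first moment, and n + m >= 4.  The second moment method
   restricted to a union U of small cubes bounds the density of the union of the
   events inside U below by a multiple of the square of the density of U.  If
   the limsup set had a cover by boxes of total volume less than 1, let U be the
   complement of finitely many of these boxes: what remains in U is covered by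
   the other boxes, whose total volume is arbitrarily small.  The contradiction
   is reached with a finitely additive content, the limit of the counting
   densities along an ultrafilter, and a compactness argument.

   Convergence.  The grid cubes whose corner satisfies the inequality with
   twice the radius form the cover of the Borel-Cantelli argument. *)

(** * Counting residues in arcs *)

Lemma leq_card_inj (T T' : finType) (f : T -> T') (A : pred T) (B : pred T') :
  {in A &, injective f} -> (forall x, A x -> B (f x)) -> (#|A| <= #|B|)%N.
Proof.
move=> injf AB; rewrite -(card_in_image injf); apply/subset_leq_card/fintype.subsetP.
by move=> y /fintype.imageP[x Ax ->]; apply: AB.
Qed.

Lemma leq_card_surj (T T' : finType) (f : T' -> T) (A : pred T) :
  (forall x, A x -> exists y, f y = x) -> (#|A| <= #|T'|)%N.
Proof.
move=> surjf; apply: leq_trans (leq_image_card f predT).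
apply/subset_leq_card/fintype.subsetP => x Ax.
by have [y <-] := surjf x Ax; apply/fintype.imageP; exists y.
Qed.

Lemma card_forall_ffun (I T : finType) (F : I -> pred T) :
  #|[pred f : {ffun I -> T} | [forall i, F i (f i)]]| = (\prod_i #|F i|)%N.
Proof.
transitivity #|family F|.
  by apply: eq_card => f; rewrite !inE.
by rewrite card_family foldrE big_map big_enum.
Qed.

Lemma natr_prod_le (R : realDomainType) (I : finType) (F : I -> nat) (B : R) :
  (forall i, (F i)%:R <= B) -> (\prod_i F i)%N%:R <= B ^+ #|I|.
Proof.
move=> FB; rewrite natr_prod -prodr_const.
by apply: ler_prod => i _; rewrite ler0n FB.
Qed.

Lemma natr_prod_ge (R : realDomainType) (I : finType) (F : I -> nat) (B : R) :
  0 <= B -> (forall i, B <= (F i)%:R) -> B ^+ #|I| <= (\prod_i F i)%N%:R.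
Proof.
move=> B0 FB; rewrite natr_prod -prodr_const.
by apply: ler_prod => i _; rewrite B0 FB.
Qed.

Section Residues.
Variable P : nat.
Hypothesis P0 : (0 < P)%N.

Fact zord_subproof (z : int) : (`|(z %% P)%Z| < P)%N.
Proof. by rewrite -ltz_nat gez0_abs ?modz_ge0 ?ltz_pmod //; lia. Qed.

Definition zord (z : int) : 'I_P := Ordinal (zord_subproof z).

Lemma zordE (z : int) : (zord z : nat)%:Z = (z %% P)%Z.
Proof. by rewrite /= gez0_abs // modz_ge0 //; lia. Qed.

Lemma zord_divE (z : int) : z = (z %/ P)%Z * P + (zord z : nat)%:Z.
Proof. by rewrite zordE -divz_eq. Qed.

Lemma zord_inj_dvd (z z' : int) : zord z = zord z' -> (P %| z - z')%Z.
Proof.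
move=> e; rewrite (zord_divE z) (zord_divE z') e.
by apply/dvdzP; exists ((z %/ P)%Z - (z' %/ P)%Z); ring.
Qed.

Lemma zord_small (z : int) : 0 <= z -> z < P -> (zord z : nat)%:Z = z.
Proof. by move=> z0 zP; rewrite zordE modz_small // z0. Qed.

Lemma zord_val (y : 'I_P) (p : int) : zord ((y : nat)%:Z + p * P) = y.
Proof.
apply/val_inj/eqP; rewrite -eqz_nat zordE addrC modzMDl modz_small //.
by rewrite ltz_nat ltn_ord.
Qed.

End Residues.
Arguments zord : simpl never.

Lemma divn_itv (v P k : nat) : (k * P <= v)%N -> (v < k.+1 * P)%N -> (v %/ P = k)%N.
Proof.
move=> H1 H2; have P0 : (0 < P)%N by case: P H1 H2 => //; rewrite !muln0.
by apply/eqP; rewrite eqn_leq -ltnS ltn_divLR // H2 leq_divRL.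
Qed.

Section Counting.
Variable R : realType.
Implicit Types (c rho y a l : R).

(** Numbering the integers of an interval from its ceiling turns upper bounds for counts into
    surjections from an ordinal type, as used by [leq_card_surj]. *)
Lemma int_in_itv a l (z : int) : a <= z%:~R -> z%:~R <= a + l ->
  exists k : 'I_(Num.truncn l).+1, z = Num.ceil a + (k : nat)%:Z.
Proof.
move=> az zl; have cz : Num.ceil a <= z by rewrite ceil_le_int.
have zc : (z - Num.ceil a)%:~R <= l by rewrite intrB; have := ceil_ge a; lra.
have k0 : 0 <= z - Num.ceil a by rewrite subr_ge0.
have l0 : 0 <= l by apply: le_trans zc; rewrite ler0z.
have kl : (`|z - Num.ceil a| < (Num.truncn l).+1)%N.
  by rewrite ltnS truncn_ge_nat // natr_absz ger0_norm.
by exists (Ordinal kl); rewrite /= gez0_abs //; lia.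
Qed.

Definition nearZ c rho y : bool := `[< exists p : int, `|y + p%:~R - c| <= rho >].

Lemma nearZP c rho y :
  reflect (exists p : int, `|y + p%:~R - c| <= rho) (nearZ c rho y).
Proof. exact: asboolP. Qed.

Lemma nearZ_shift c rho y (k : int) : nearZ c rho (y + k%:~R) = nearZ c rho y.
Proof.
apply/nearZP/nearZP => -[p Hp].
  by exists (k + p); rewrite intrD addrA.
by exists (p - k); move: Hp; rewrite intrB; congr (`|_| <= _); ring.
Qed.

Lemma nearZ_zord (P : nat) (P0 : (0 < P)%N) c rho (z : int) :
  nearZ c rho ((zord P0 z : nat)%:R / P%:R) = nearZ c rho (z%:~R / P%:R).
Proof.
rewrite [in RHS](zord_divE P0 z) intrD intrM mulrDl mulfK ?pnatr_eq0 -?lt0n //.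
by rewrite addrC nearZ_shift.
Qed.

(** Lifting a residue [y] to the integer [y + p * P] puts it in an interval of length 2 rho P, which
    holds at most 2 rho P + 1 integers; the hypothesis [1 <= rho * P%:R] absorbs the 1. *)
Lemma card_arc (P : nat) c rho : (0 < P)%N -> 1 <= rho * P%:R ->
  #|[pred y : 'I_P | nearZ c rho ((y : nat)%:R / P%:R)]|%:R <= 3 * rho * P%:R.
Proof.
move=> P0 rP; have Pr : 0 < P%:R :> R by rewrite ltr0n.
pose f (k : 'I_(Num.truncn (2 * rho * P%:R)).+1) :=
  zord P0 (Num.ceil (P%:R * (c - rho)) + (k : nat)%:Z).
have H := @leq_card_surj _ _ f [pred y : 'I_P | nearZ c rho ((y : nat)%:R / P%:R)].
apply: le_trans (_ : (Num.truncn (2 * rho * P%:R)).+1%:R <= _); last first.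
  have t0 : 0 <= 2 * rho * P%:R by lra.
  by rewrite -natr1; have := truncn_le (2 * rho * P%:R); rewrite t0; lra.
rewrite ler_nat -[X in (_ <= X)%N]card_ord; apply: H => y /= /nearZP[p].
rewrite ler_distl => /andP[H1 H2].
have e : (y : nat)%:R / P%:R * P%:R = (y : nat)%:R :> R by rewrite divfK // gt_eqF.
have [|| k Hk] := @int_in_itv (P%:R * (c - rho)) (2 * rho * P%:R) ((y : nat)%:Z + p * P).
- rewrite intrD intrM -!pmulrn -e mulrC -mulrDl ler_pM2r //; lra.
- rewrite intrD intrM -!pmulrn -e -mulrDl.
  rewrite [X in _ <= X](_ : _ = (c + rho) * P%:R); last by ring.
  by rewrite ler_pM2r //; lra.
by exists k; rewrite /f -Hk zord_val.
Qed.

(* If k and k' witness the two conditions on t, then h = e k - s k' lies in an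
   interval of length 4 e rho, h determines k' modulo e, and k' confines t to an
   interval of length 2 rho' P / e. *)
Lemma card_two_arcs (P s e : nat) c rho c' rho' :
  (0 < P)%N -> (0 < s)%N -> (0 < e)%N -> coprime s e -> 0 <= rho -> rho' <= 1 / 4 ->
  s%:R * rho' <= e%:R * rho -> e%:R <= rho' * P%:R ->
  #|[pred t : 'I_P | nearZ c rho ((s * t)%:R / P%:R) &&
                     nearZ c' rho' ((e * t)%:R / P%:R)]|%:R
  <= P%:R * (24 * (rho * rho') + 6 * (rho' / e%:R)).
Proof.
move=> P0 s0 e0 cop r0 r'4 sre eP.
have Pr : 0 < P%:R :> R by rewrite ltr0n.
have er : 0 < e%:R :> R by rewrite ltr0n.
have er1 : 1 <= e%:R :> R by rewrite ler1n.
have r'0 : 0 <= rho'.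
  rewrite -(pmulr_lge0 _ Pr); exact: le_trans (ltW er) eP.
(* [u] inverts [s] modulo [e], so h = e k - s k' gives k' = - h u modulo [e]. *)
have [u Hu] : exists u : int, (e %| u * s - 1)%Z.
  have [u [v Huv]] := Bezoutz s e; exists u.
  rewrite (_ : u * s - 1 = - v * e) ?dvdz_mull //.
  by have := Huv; rewrite /gcdz /= (eqP cop) mulNr; lia.
pose H := (Num.truncn (4 * e%:R * rho)).+1.
pose M := (Num.truncn (2 * rho' * P%:R / e%:R)).+1.
pose kap := Num.ceil (c' - rho' - e%:R).
pose h0 := Num.ceil (e%:R * c - s%:R * c' - 2 * e%:R * rho).
(* The least integer not below [kap] in the residue class prescribed by h, plus 0 or [e]: the
   possible k' lie in a window from [kap] of length less than 2 e. *)
pose k' (a : 'I_H) (j : 'I_2) : int :=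
  kap + ((- ((h0 + (a : nat)%:Z) * u) - kap) %% e)%Z + e%:Z * (j : nat)%:Z.
pose f (x : 'I_H * 'I_2 * 'I_M) := zord P0
  (Num.ceil (P%:R * (c' - (k' x.1.1 x.1.2)%:~R - rho') / e%:R) + (x.2 : nat)%:Z).
apply: le_trans (_ : (H * 2 * M)%:R <= _); last first.
  have HH : H%:R <= 4 * e%:R * rho + 1.
    rewrite /H -natr1 lerD2r truncn_le; nra.
  have q0 : 0 <= rho' * P%:R / e%:R by rewrite divr_ge0 ?mulr_ge0 ?ler0n.
  have q1 : 1 <= rho' * P%:R / e%:R by rewrite ler_pdivlMr // mul1r.
  have MM : M%:R <= 3 * (rho' * P%:R / e%:R).
    rewrite /M -natr1; have := truncn_le (2 * rho' * P%:R / e%:R).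
    rewrite (_ : 2 * rho' * P%:R / e%:R = 2 * (rho' * P%:R / e%:R)); last by ring.
    by rewrite mulr_ge0 //; lra.
  rewrite !natrM; apply: le_trans (_ : (4 * e%:R * rho + 1) * 2 * (3 * (rho' * P%:R / e%:R)) <= _).
    by apply: ler_pM => //; rewrite ler_pM2r.
  by rewrite le_eqVlt; apply/orP; left; apply/eqP; field; rewrite gt_eqF.
rewrite ler_nat.
have -> : (H * 2 * M = #|{: 'I_H * 'I_2 * 'I_M}|)%N by rewrite !card_prod !card_ord.
apply: (@leq_card_surj _ _ f) => t /= /andP[/nearZP[k Hk] /nearZP[k2 Hk2]].
have tP : (t : nat)%:R < P%:R :> R by rewrite ltr_nat.
have t0 : 0 <= (t : nat)%:R :> R by rewrite ler0n.
have yE : (t : nat)%:R / P%:R * P%:R = (t : nat)%:R :> R by rewrite divfK // gt_eqF.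
set y : R := (t : nat)%:R / P%:R in yE.
have y0 : 0 <= y by rewrite divr_ge0.
have y1 : y < 1 by rewrite ltr_pdivrMr // mul1r.
have sy : (s * t)%:R / P%:R = s%:R * y by rewrite natrM mulrA.
have ey : (e * t)%:R / P%:R = e%:R * y by rewrite natrM mulrA.
move: Hk Hk2; rewrite sy ey !ler_distl => /andP[A1 A2] /andP[B1 B2].
have sr : 0 <= s%:R :> R by rewrite ler0n.
have [|| a Ha] := @int_in_itv (e%:R * c - s%:R * c' - 2 * e%:R * rho) (4 * e%:R * rho)
    (e%:Z * k - s%:Z * k2).
- rewrite intrB !intrM -!pmulrn; nra.
- rewrite intrB !intrM -!pmulrn; nra.
have kap_le : kap <= k2.
  by rewrite ceil_le_int; nra.
have kap_ge : k2 - kap < 2 * e%:Z.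
  have : (k2 - kap)%:~R < e%:R + 1 :> R.
    by rewrite intrB; have := ceil_ge (c' - rho' - e%:R); rewrite -/kap; nra.
  rewrite (_ : e%:R + 1 = (e%:Z + 1)%:~R); last by rewrite intrD.
  by rewrite ltr_int; move: (k2 - kap) => z; move: e0; clear; lia.
have modE : ((- ((h0 + (a : nat)%:Z) * u) - kap) %% e)%Z = ((k2 - kap) %% e)%Z.
  apply/eqP; rewrite eqz_mod_dvd -Ha.
  have -> : - ((e%:Z * k - s%:Z * k2) * u) - kap - (k2 - kap) =
      (u * s - 1) * k2 - (k * u) * e by ring.
  by apply: rpredB; [exact: dvdz_mulr | exact: dvdz_mull].
have d0 : 0 <= ((k2 - kap) %/ e)%Z by rewrite divz_ge0 ?subr_ge0 // ltz_nat.
have j2 : (`|((k2 - kap) %/ e)%Z| < 2)%N.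
  by rewrite -ltz_nat gez0_abs // ltz_divLR // ltz_nat.
have k'E : k' a (Ordinal j2) = k2.
  rewrite /k' modE /= gez0_abs //; have E := divz_eq (k2 - kap) e.
  by rewrite [e%:Z * _]mulrC -addrA [X in kap + X]addrC -E addrC subrK.
have [|| l Hl] := @int_in_itv (P%:R * (c' - k2%:~R - rho') / e%:R)
    (2 * rho' * P%:R / e%:R) (t : nat)%:Z.
- by rewrite -pmulrn ler_pdivrMr // -yE; nra.
- rewrite -pmulrn -mulrDl ler_pdivlMr // -yE; nra.
exists (a, Ordinal j2, l); rewrite /f /= k'E -Hl.
by have := zord_val P0 t 0; rewrite mul0r addr0.
Qed.

(** When [s%:R * rho'] exceeds [e%:R * rho], the two arcs exchange roles; the excess is then rho /
    s, which is smaller than rho' / e. *)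
Lemma card_two_arcs_sym (P s e : nat) c rho c' rho' :
  (0 < P)%N -> (0 < s)%N -> (s <= e)%N -> coprime s e ->
  0 <= rho' -> rho <= 1 / 4 -> rho' <= 1 / 4 ->
  s%:R <= rho * P%:R -> e%:R <= rho' * P%:R ->
  #|[pred t : 'I_P | nearZ c rho ((s * t)%:R / P%:R) &&
                     nearZ c' rho' ((e * t)%:R / P%:R)]|%:R
  <= P%:R * (24 * (rho * rho') + 6 * (rho' / e%:R)).
Proof.
move=> P0 s0 se cop r'0 r4 r'4 sP eP.
have Pr : 0 < P%:R :> R by rewrite ltr0n.
have e0 : (0 < e)%N by apply: leq_trans se.
have sr : 0 < s%:R :> R by rewrite ltr0n.
have er : 0 < e%:R :> R by rewrite ltr0n.
have r0 : 0 <= rho by rewrite -(pmulr_lge0 _ Pr); exact: le_trans (ltW sr) sP.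
have [h|h] := leP (s%:R * rho') (e%:R * rho).
  exact: card_two_arcs.
have := @card_two_arcs P e s c' rho' c rho P0 e0 s0.
rewrite coprime_sym => /(_ cop r'0 r4 (ltW h) sP) H.
rewrite (eq_card (B := [pred t : 'I_P | nearZ c' rho' ((e * t)%:R / P%:R) &&
   nearZ c rho ((s * t)%:R / P%:R)])); last by move=> t; rewrite !inE andbC.
apply: le_trans H _; rewrite ler_pM2l // [rho' * rho]mulrC lerD2l ler_pM2l //.
by rewrite ler_pdivrMr // mulrAC ler_pdivlMr // mulrC [rho' * _]mulrC ltW.
Qed.

(** The condition says that x / P lies in [k / L, (k + 1) / L). There are at least P / L - 1 such x,
    and this is at least half of P / L because P / L >= 2. *)
Lemma card_cell (P L k : nat) : (0 < L)%N -> (2 * L <= P)%N -> (k < L)%N ->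
  P%:R / (2 * L%:R) <= #|[pred x : 'I_P | ((x * L) %/ P == k)%N]|%:R :> R.
Proof.
move=> L0 LP kL; have P0 : (0 < P)%N by lia.
have Pr : 0 < P%:R :> R by rewrite ltr0n.
have Lr : 0 < L%:R :> R by rewrite ltr0n.
pose M := Num.truncn (P%:R / L%:R : R).
pose f (l : 'I_M) := zord P0 (Num.ceil (k%:R * P%:R / L%:R : R) + (l : nat)%:Z).
have LP2 : 2 * L%:R <= P%:R :> R by rewrite -natrM ler_nat.
have q2 : 2 <= P%:R / L%:R :> R by rewrite ler_pdivlMr.
have fP (l : 'I_M) : let X := Num.ceil (k%:R * P%:R / L%:R : R) + (l : nat)%:Z in
   [/\ (zord P0 X : nat)%:Z = X, k%:R * P%:R <= X%:~R * L%:R :> R &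
       X%:~R * L%:R < k.+1%:R * P%:R :> R].
  move=> X; have lM : ((l : nat).+1%:R : R) <= P%:R / L%:R.
    have := ltn_ord l; rewrite -(ler_nat R) => /le_trans; apply.
    by rewrite truncn_le; lra.
  have := ceil_itv (k%:R * P%:R / L%:R : R); rewrite intrB => /andP[c1 c2].
  have XE : X%:~R = (Num.ceil (k%:R * P%:R / L%:R : R))%:~R + (l : nat)%:R :> R.
    by rewrite intrD.
  have l0 : 0 <= (l : nat)%:R :> R by rewrite ler0n.
  have H1 : k%:R * P%:R <= X%:~R * L%:R :> R by rewrite -ler_pdivrMr // XE; lra.
  have H2 : X%:~R * L%:R < k.+1%:R * P%:R :> R.
    rewrite -ltr_pdivlMr // XE -natr1 mulrDl mul1r mulrDl.
    by move: lM; rewrite -natr1; lra.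
  split=> //; apply: zord_small.
    rewrite -(ler0z R) -(pmulr_lge0 _ Lr) mulrC.
    by rewrite mulrC (le_trans _ H1) // mulr_ge0 ?ler0n.
  rewrite -(ltr_int R) -(ltr_pM2r Lr); apply: lt_le_trans H2 _.
  by rewrite mulrC ler_pM2l // ler_nat.
apply: le_trans (_ : M%:R <= _).
  have : P%:R / L%:R - 1 <= M%:R :> R.
    by rewrite lerBlDr natr1 ltW // truncnS_gt.
  by rewrite invfM; lra.
rewrite ler_nat -[X in (X <= _)%N]card_ord.
apply: (@leq_card_inj _ _ f) => [l l' _ _ /(congr1 (fun z : 'I_P => (z : nat)%:Z))|l _].
  have [E _ _] := fP l; have [E' _ _] := fP l'.
  by rewrite /f E E' => /addrI [] /val_inj.
have [E H1 H2] := fP l; move: H1 H2; rewrite -E -/(f l).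
change (k%:R * P%:R <= (f l : nat)%:~R * L%:R :> R -> (f l : nat)%:~R * L%:R < k.+1%:R * P%:R :> R ->
  (((f l : nat) * L) %/ P == k)%N).
move: (f l) => z; rewrite -!pmulrn -!natrM ler_nat ltr_nat => H1 H2.
by apply/eqP/divn_itv.
Qed.

(** While x / P crosses a cell of length 1 / L, the point (Q x + s) / P turns about Q / L times
    around the circle. At least Q / (2 L) turns are complete, and each puts at least rho P / Q
    values of x in the arc. *)
Lemma card_cell_arc (P L k Q : nat) (s : int) c rho :
  (0 < L)%N -> (0 < P)%N -> (k < L)%N -> (4 * L <= Q)%N -> rho <= 1 / 4 ->
  Q%:R <= rho * P%:R ->
  rho * P%:R / (2 * L%:R) <=
  #|[pred x : 'I_P | ((x * L) %/ P == k)%N &&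
      nearZ c rho ((Q%:Z * (x : nat)%:Z + s)%:~R / P%:R)]|%:R :> R.
Proof.
move=> L0 P0 kL LQ r4 QP; have Q0 : (0 < Q)%N by lia.
have Pr : 0 < P%:R :> R by rewrite ltr0n.
have Lr : 0 < L%:R :> R by rewrite ltr0n.
have Qr : 0 < Q%:R :> R by rewrite ltr0n.
have QPr : 0 < rho * P%:R by apply: lt_le_trans QP.
have r0 : 0 < rho by rewrite -(pmulr_lgt0 _ Pr).
pose M := Num.truncn (2 * rho * P%:R / Q%:R).
(* One turn is given up for the incomplete turns at the ends of the cell. Below, [b0] is the first
   turn whose arc starts inside the cell, and [st a] is where arc number [a] begins, as a real value
   of x. *)
pose K := (Q %/ L - 1)%N.
pose b0 := Num.ceil (Q%:R * k%:R / L%:R + s%:~R / P%:R - c + rho).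
pose st (a : nat) : R := (P%:R * (c + b0%:~R + a%:R - rho) - s%:~R) / Q%:R.
pose X (x : 'I_K * 'I_M) : int := Num.ceil (st x.1) + (x.2 : nat)%:Z.
have KQ : (K.+1 * L <= Q)%N.
  by rewrite /K -addn1 subnK ?leq_divM // divn_gt0 //; lia.
have XP (x : 'I_K * 'I_M) : st x.1 <= (X x)%:~R /\ (X x)%:~R <= st x.1 + 2 * rho * P%:R / Q%:R.
  have lM : ((x.2 : nat).+1%:R : R) <= 2 * rho * P%:R / Q%:R.
    have := ltn_ord x.2; rewrite -(ler_nat R) => /le_trans; apply.
    by rewrite truncn_le divr_ge0 ?mulr_ge0 // ?ltW.
  have := ceil_itv (st x.1); rewrite intrB => /andP[c1 c2].
  have XE : (X x)%:~R = (Num.ceil (st x.1))%:~R + (x.2 : nat)%:R :> R by rewrite intrD.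
  have l0 : 0 <= (x.2 : nat)%:R :> R by rewrite ler0n.
  by rewrite XE; move: lM; rewrite -natr1; lra.
have stE (a : nat) : st a * Q%:R = P%:R * (c + b0%:~R + a%:R - rho) - s%:~R.
  by rewrite divfK // gt_eqF.
have eE : 2 * rho * P%:R / Q%:R * Q%:R = 2 * rho * P%:R by rewrite divfK // gt_eqF.
have XQ (x : 'I_K * 'I_M) : P%:R * (c + b0%:~R + (x.1 : nat)%:R - rho) - s%:~R <= (X x)%:~R * Q%:R /\
   (X x)%:~R * Q%:R <= P%:R * (c + b0%:~R + (x.1 : nat)%:R + rho) - s%:~R.
  have [H1 H2] := XP x; split; first by rewrite -stE ler_pM2r.
  rewrite -(ler_pM2r Qr) (mulrDl (st x.1)) stE eE in H2; move: H2; clear => H; lra.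
have /andP[b1 b2] := ceil_itv (Q%:R * k%:R / L%:R + s%:~R / P%:R - c + rho).
move: b1 b2; rewrite -/b0 intrB => b1 b2.
have sE : s%:~R / P%:R * P%:R = s%:~R :> R by rewrite divfK // gt_eqF.
have kE : Q%:R * k%:R / L%:R * L%:R = Q%:R * k%:R :> R by rewrite divfK // gt_eqF.
set kk : R := Q%:R * k%:R / L%:R in b1 b2 kE.
set ss : R := s%:~R / P%:R in b1 b2 sE.
have Xlo (x : 'I_K * 'I_M) : P%:R * k%:R <= (X x)%:~R * L%:R :> R.
  have [H1 _] := XQ x.
  have a0 : 0 <= (x.1 : nat)%:R :> R by rewrite ler0n.
  have : P%:R * kk <= (X x)%:~R * Q%:R by apply: le_trans H1; rewrite -sE; nra.
  rewrite -(ler_pM2r Lr) -mulrA kE mulrCA mulrA -mulrA [_ * Q%:R * _]mulrAC.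
  by rewrite [Q%:R * _]mulrC ler_pM2r.
have Xhi (x : 'I_K * 'I_M) : (X x)%:~R * L%:R < P%:R * k.+1%:R :> R.
  have [_ H2] := XQ x.
  have aK : (x.1 : nat)%:R + 1 <= K%:R :> R by rewrite natr1 ler_nat.
  have H3 : (X x)%:~R * Q%:R < P%:R * (kk + K%:R + 1).
    apply: le_lt_trans H2 _; rewrite -sE; nra.
  have H4 : (kk + K%:R + 1) * L%:R <= Q%:R * k.+1%:R.
    have : K.+1%:R * L%:R <= Q%:R :> R by rewrite -natrM ler_nat.
    by rewrite -!natr1; move: kE; nra.
  rewrite -(ltr_pM2r Qr); move: H3; rewrite -(ltr_pM2r Lr) => H3.
  have H5 : P%:R * ((kk + K%:R + 1) * L%:R) <= P%:R * (Q%:R * k.+1%:R) by rewrite ler_pM2l.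
  nra.
have Xsmall (x : 'I_K * 'I_M) : (zord P0 (X x) : nat)%:Z = X x.
  apply: zord_small.
    by rewrite -(ler0z R) -(pmulr_lge0 _ Lr) (le_trans _ (Xlo x)) // mulr_ge0 ?ler0n.
  rewrite -(ltr_int R) -(ltr_pM2r Lr); apply: lt_le_trans (Xhi x) _.
  by rewrite ler_pM2l // ler_nat.
apply: le_trans (_ : (K * M)%:R <= _).
  rewrite natrM.
  have M1 : rho * P%:R / Q%:R <= M%:R.
    have q1 : 1 <= rho * P%:R / Q%:R by rewrite ler_pdivlMr // mul1r.
    have : 2 * rho * P%:R / Q%:R - 1 <= M%:R :> R.
      by rewrite lerBlDr natr1 ltW // truncnS_gt.
    by rewrite (_ : 2 * rho * P%:R / Q%:R = 2 * (rho * P%:R / Q%:R)); [lra|ring].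
  have K1 : Q%:R / (2 * L%:R) <= K%:R :> R.
    rewrite ler_pdivrMr ?mulr_gt0 // -!natrM ler_nat /K.
    have d4 : (4 <= Q %/ L)%N by rewrite leq_divRL.
    have := ltn_ceil Q L0; move: (Q %/ L)%N d4; clear => d d4.
    by have -> : d = (d - 4 + 4)%N; [rewrite subnK | move: (d - 4)%N => ?; nia].
  have -> : rho * P%:R / (2 * L%:R) = Q%:R / (2 * L%:R) * (rho * P%:R / Q%:R).
    by field; rewrite !gt_eqF.
  by apply: ler_pM => //; rewrite divr_ge0 ?mulr_ge0 ?ltW.
rewrite ler_nat -[K]card_ord -[M]card_ord -card_prod.
apply: (@leq_card_inj _ _ (fun x => zord P0 (X x))) => [x x' _ _ E|x _].
  have EX : X x = X x' by rewrite -Xsmall E Xsmall.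
  have [H1 H2] := XQ x; have [H1' H2'] := XQ x'.
  have E1 : x.1 = x'.1 :> nat.
    (* Since rho <= 1 / 4, the arcs of distinct turns are disjoint, so [X x] determines its turn. *)
    have key (i j : nat) (z : R) :
       P%:R * (c + b0%:~R + i%:R - rho) - s%:~R <= z ->
       z <= P%:R * (c + b0%:~R + j%:R + rho) - s%:~R -> (i <= j)%N.
      move=> A B; rewrite leqNgt -ltnS ltnS; apply/negP; rewrite -(ler_nat R) -natr1 => ij.
      have : P%:R * (i%:R - rho) <= P%:R * (j%:R + rho) by lra.
      by rewrite ler_pM2l //; lra.
    apply/eqP; rewrite eqn_leq; apply/andP; split.
      by apply: (key _ _ ((X x)%:~R * Q%:R)) => //; rewrite EX.
    by apply: (key _ _ ((X x)%:~R * Q%:R)) => //; rewrite EX.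
  have E2 : x.2 = x'.2 :> nat by move: EX; rewrite /X E1 => /addrI [].
  by move: x x' E1 E2 {E EX H1 H2 H1' H2'} => [a l] [a' l'] /= /val_inj -> /val_inj ->.
apply/andP; split.
  change (((zord P0 (X x) : nat) * L) %/ P == k)%N.
  have := Xlo x; have := Xhi x; have := Xsmall x; move: (zord P0 (X x)) => z <-.
  rewrite -!pmulrn -!natrM ler_nat ltr_nat => H1 H2.
  by apply/eqP/divn_itv; rewrite [(_ * P)%N]mulnC.
change (nearZ c rho ((Q%:Z * (zord P0 (X x) : nat)%:Z + s)%:~R / P%:R)).
rewrite Xsmall.
apply/nearZP; exists (- (b0 + (x.1 : nat)%:Z)).
have [H1 H2] := XQ x.
rewrite intrN !intrD intrM -!pmulrn ler_distl.
have -> : (Q%:R * (X x)%:~R + s%:~R) / P%:R = ((X x)%:~R * Q%:R + s%:~R) / P%:R :> R.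
  by rewrite [Q%:R * _]mulrC.
set W := (_ + s%:~R) / _.
have WE : W * P%:R = (X x)%:~R * Q%:R + s%:~R by rewrite divfK // gt_eqF.
apply/andP; split.
  by rewrite lerBrDr -(ler_pM2r Pr) WE; move: H1; clear => H; lra.
by rewrite lerBlDr -(ler_pM2r Pr) WE; move: H2; clear => H; lra.
Qed.

End Counting.

(** * Linear forms modulo a prime *)

Section LinearForms.
Variables (P n : nat).
Hypothesis Pprime : prime P.
Let P0 : (0 < P)%N := prime_gt0 Pprime.
Implicit Types (w v : 'I_n -> int) (x : {ffun 'I_n -> 'I_P}).

Definition lin w x : int := \sum_i w i * (x i : nat)%:Z.

Definition upd x (i0 : 'I_n) (y : 'I_P) : {ffun 'I_n -> 'I_P} :=
  [ffun i => if i == i0 then y else x i].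

Lemma linB w x x' : lin w x - lin w x' = \sum_i w i * ((x i : nat)%:Z - (x' i : nat)%:Z).
Proof. by rewrite /lin -sumrB; apply: eq_bigr => i _; rewrite mulrBr. Qed.

Lemma lin_upd w x i0 y :
  lin w (upd x i0 y) = lin w x + w i0 * ((y : nat)%:Z - (x i0 : nat)%:Z).
Proof.
have := linB w (upd x i0 y) x; rewrite (bigD1 i0) //= big1 => [|i /negPf ii0].
  by rewrite ffunE eqxx addr0 => <-; rewrite addrC subrK.
by rewrite ffunE ii0 subrr mulr0.
Qed.

Lemma prime_dvdz_mull (a b : int) : ~~ (P %| a)%Z -> (P %| a * b)%Z -> (P %| b)%Z.
Proof. by move=> Pa; rewrite Gauss_dvdzr // coprimezE /= prime_coprime. Qed.

Lemma ord_dvdz_eq (y y' : 'I_P) : (P %| (y : nat)%:Z - (y' : nat)%:Z)%Z -> y = y'.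
Proof.
rewrite -eqz_mod_dvd !modz_small ?ltz_nat ?ltn_ord // => /eqP [].
exact: val_inj.
Qed.

(** Replacing coordinate [i0] by the value of the form is injective, because [w i0] is invertible
    modulo [P]; the image lies in a product set. *)
Lemma card_lin1 w (i0 : 'I_n) (T : pred 'I_P) : ~~ (P %| w i0)%Z ->
  (#|[pred x | T (zord P0 (lin w x))]| <= #|T| * P ^ n.-1)%N.
Proof.
move=> Pw.
pose F (i : 'I_n) : pred 'I_P := if i == i0 then T else predT.
have -> : (#|T| * P ^ n.-1 = #|[pred x : {ffun 'I_n -> 'I_P} | [forall i, F i (x i)]]|)%N.
  rewrite card_forall_ffun (bigD1 i0) //= {1}/F eqxx; congr (_ * _)%N.
  rewrite (eq_bigr (fun=> P)) => [|i /negPf ii0]; last by rewrite /F ii0 card_ord.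
  by rewrite prod_nat_const cardC1 card_ord.
apply: (@leq_card_inj _ _ (fun x => upd x i0 (zord P0 (lin w x)))) => [x x' _ _ /ffunP E|x Tx].
  have Ei i : i != i0 -> x i = x' i by have := E i; rewrite !ffunE => + /negPf ii0; rewrite ii0.
  apply/ffunP => i; have [->|/Ei //] := eqVneq i i0.
  apply: ord_dvdz_eq; apply: (prime_dvdz_mull Pw).
  have := E i0; rewrite !ffunE eqxx => /zord_inj_dvd; rewrite linB (bigD1 i0) //= big1 ?addr0 //.
  by move=> k /Ei ->; rewrite subrr mulr0.
by apply/forallP => i; rewrite /F ffunE; case: eqP.
Qed.

(** The same substitution, now in two coordinates: it is injective by Cramer's rule, the 2 x 2 minor
    being invertible modulo [P]. *)
Lemma card_lin2 w v (i0 i1 : 'I_n) (T T' : pred 'I_P) :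
  ~~ (P %| w i0 * v i1 - w i1 * v i0)%Z ->
  (#|[pred x | T (zord P0 (lin w x)) && T' (zord P0 (lin v x))]| <= #|T| * #|T'| * P ^ n.-2)%N.
Proof.
move=> PD; have i01 : i1 != i0.
  by apply: contraNneq PD => ->; rewrite mulrC subrr dvdz0.
pose F (i : 'I_n) : pred 'I_P := if i == i0 then T else if i == i1 then T' else predT.
have -> : (#|T| * #|T'| * P ^ n.-2 = #|[pred x : {ffun 'I_n -> 'I_P} | [forall i, F i (x i)]]|)%N.
  rewrite card_forall_ffun (bigD1 i0) //= (bigD1 i1) //= {1 2}/F !eqxx (negPf i01) mulnA.
  congr (_ * _)%N; rewrite (eq_bigr (fun=> P)) => [|i /andP[/negPf a /negPf b]]; last first.
    by rewrite /F a b card_ord.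
  rewrite prod_nat_const; congr (_ ^ _)%N.
  rewrite (eq_card (B := [predD1 predC1 i0 & i1])); last by move=> i; rewrite !inE andbC.
  have i1in : i1 \in predC1 i0 by rewrite inE.
  by have := cardC1 i0; rewrite (cardD1 i1 (predC1 i0)) i1in card_ord add1n => <-.
apply: (@leq_card_inj _ _ (fun x => upd (upd x i0 (zord P0 (lin w x))) i1 (zord P0 (lin v x))))
   => [x x' _ _ /ffunP E|x /andP[Tx Tx']].
  have Ei i : i != i0 -> i != i1 -> x i = x' i.
    by have := E i; rewrite !ffunE => + /negPf a /negPf b; rewrite a b.
  have L (u : 'I_n -> int) : lin u x - lin u x' =
      u i0 * ((x i0 : nat)%:Z - (x' i0 : nat)%:Z) + u i1 * ((x i1 : nat)%:Z - (x' i1 : nat)%:Z).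
    rewrite linB (bigD1 i0) //= (bigD1 i1) //= big1 ?addr0 // => k /andP[a b].
    by rewrite Ei // subrr mulr0.
  have E1 : (P %| lin w x - lin w x')%Z.
    by have := E i0; rewrite !ffunE eqxx eq_sym (negPf i01) => /zord_inj_dvd.
  have E2 : (P %| lin v x - lin v x')%Z.
    by have := E i1; rewrite !ffunE eqxx => /zord_inj_dvd.
  move: E1 E2; rewrite !L.
  set d0 := (x i0 : nat)%:Z - _; set d1 := (x i1 : nat)%:Z - _ => E1 E2.
  have D0 : (P %| d0)%Z.
    apply: (prime_dvdz_mull PD).
    have -> : (w i0 * v i1 - w i1 * v i0) * d0 =
      v i1 * (w i0 * d0 + w i1 * d1) - w i1 * (v i0 * d0 + v i1 * d1) by ring.
    by apply: rpredB; apply: dvdz_mull.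
  have D1 : (P %| d1)%Z.
    apply: (prime_dvdz_mull PD).
    have -> : (w i0 * v i1 - w i1 * v i0) * d1 =
      w i0 * (v i0 * d0 + v i1 * d1) - v i0 * (w i0 * d0 + w i1 * d1) by ring.
    by apply: rpredB; apply: dvdz_mull.
  apply/ffunP => i; have [->|a] := eqVneq i i0; first exact: ord_dvdz_eq.
  have [->|b] := eqVneq i i1; first exact: ord_dvdz_eq.
  exact: Ei.
apply/forallP => i; rewrite /F !ffunE; have [->|a] := eqVneq i i0.
  by rewrite eq_sym (negPf i01).
by case: (i == i1).
Qed.

Section RealCounts.
Variable R : realType.
Implicit Types (c rho : R).

Let Pr : 0 < P%:R :> R. Proof. by rewrite ltr0n. Qed.

Definition near_col w c rho x : bool := nearZ c rho ((lin w x)%:~R / P%:R).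

Lemma nearZ_dvd c rho (z z' : int) : (P %| z - z')%Z ->
  nearZ c rho (z%:~R / P%:R) = nearZ c rho (z'%:~R / P%:R).
Proof.
move=> /dvdzP[k Hk]; have -> : z = z' + k * P by rewrite -Hk; ring.
by rewrite intrD intrM mulrDl mulfK ?gt_eqF // nearZ_shift.
Qed.

Lemma natr_le_trans (a b : nat) (B : R) : (a <= b)%N -> b%:R <= B -> a%:R <= B.
Proof. by rewrite -(ler_nat R); apply: le_trans. Qed.

Lemma card_col_single w i0 c rho : ~~ (P %| w i0)%Z -> 1 <= rho * P%:R ->
  #|[pred x | near_col w c rho x]|%:R <= 3 * rho * P%:R ^+ n.
Proof.
move=> Pw rP; have n0 : (0 < n)%N by apply: leq_ltn_trans (ltn_ord i0).
rewrite (eq_card (B := [pred x | [pred y : 'I_P | nearZ c rho ((y : nat)%:R / P%:R)]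
   (zord P0 (lin w x))])); last by move=> x; rewrite !inE nearZ_zord.
apply: natr_le_trans (card_lin1 _ Pw) _.
rewrite natrM natrX -[in X in _ <= _ * _ ^+ X](prednK n0) exprS mulrA ler_pM2r ?exprn_gt0 //.
exact: card_arc.
Qed.

Lemma card_col_indep w v i0 i1 c rho c' rho' :
  ~~ (P %| w i0 * v i1 - w i1 * v i0)%Z -> 1 <= rho * P%:R -> 1 <= rho' * P%:R ->
  #|[pred x | near_col w c rho x && near_col v c' rho' x]|%:R <= 9 * (rho * rho') * P%:R ^+ n.
Proof.
move=> PD rP rP'; have i01 : i1 != i0.
  by apply: contraNneq PD => ->; rewrite mulrC subrr dvdz0.
have n1 : (1 < n)%N.
  have := ltn_ord i0; have := ltn_ord i1; move: i01; rewrite -val_eqE /=; lia.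
rewrite (eq_card (B := [pred x |
  [pred y : 'I_P | nearZ c rho ((y : nat)%:R / P%:R)] (zord P0 (lin w x)) &&
  [pred y : 'I_P | nearZ c' rho' ((y : nat)%:R / P%:R)] (zord P0 (lin v x))]));
  last by move=> x; rewrite !inE !nearZ_zord.
apply: natr_le_trans (card_lin2 _ _ PD) _; rewrite !natrM natrX.
have -> : 9 * (rho * rho') * P%:R ^+ n = (3 * rho * P%:R) * (3 * rho' * P%:R) * P%:R ^+ n.-2.
  by rewrite -[in LHS](subnKC n1) subn2 !exprS; ring.
rewrite ler_pM2r ?exprn_gt0 //; apply: ler_pM => //; exact: card_arc.
Qed.

(** Both conditions depend only on the residue t of [lin z x], which [card_lin1] shows to be evenly
    spread, so the count reduces to two arcs in the single variable t. *)
Lemma card_col_par w v (z : 'I_n -> int) i0 (s e : nat) c rho c' rho' :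
  (forall i, w i = s%:Z * z i) -> (forall i, v i = e%:Z * z i) -> ~~ (P %| z i0)%Z ->
  (0 < s)%N -> (s <= e)%N -> coprime s e -> rho <= 1 / 4 -> rho' <= 1 / 4 ->
  s%:R <= rho * P%:R -> e%:R <= rho' * P%:R ->
  #|[pred x | near_col w c rho x && near_col v c' rho' x]|%:R <=
  (24 * (rho * rho') + 6 * (rho' / e%:R)) * P%:R ^+ n.
Proof.
move=> ws ve Pz s0 se cop r4 r4' sP eP.
have n0 : (0 < n)%N by apply: leq_ltn_trans (ltn_ord i0).
have r'0 : 0 <= rho' by rewrite -(pmulr_lge0 _ Pr); apply: le_trans eP.
have linz (u : 'I_n -> int) (a : nat) x : (forall i, u i = a%:Z * z i) -> lin u x = a%:Z * lin z x.
  by move=> ua; rewrite /lin mulr_sumr; apply: eq_bigr => i _; rewrite ua mulrA.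
have near (u : 'I_n -> int) (a : nat) c0 r0 x : (forall i, u i = a%:Z * z i) ->
    near_col u c0 r0 x = nearZ c0 r0 ((a * zord P0 (lin z x))%:R / P%:R).
  move=> ua; rewrite /near_col (linz u a) // -[(_ * _)%:R]/((_ * _)%N%:Z%:~R).
  apply: nearZ_dvd; rewrite PoszM -mulrBr dvdz_mull //.
  by rewrite {1}(zord_divE P0 (lin z x)) addrK dvdz_mull.
rewrite (eq_card (B := [pred x | [pred t : 'I_P | nearZ c rho ((s * t)%:R / P%:R) &&
   nearZ c' rho' ((e * t)%:R / P%:R)] (zord P0 (lin z x))])); last first.
  by move=> x; rewrite !inE (near w s) // (near v e).
apply: natr_le_trans (card_lin1 _ Pz) _.
rewrite natrM natrX -[in X in _ <= _ * _ ^+ X](prednK n0) exprS mulrA ler_pM2r ?exprn_gt0 //.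
by rewrite [X in _ <= X]mulrC; apply: card_two_arcs_sym.
Qed.

(** Fibring over all coordinates but [i0]: with the others fixed in their cells, the condition on
    coordinate [i0] is of the form Q y + const, which [card_cell_arc] counts. *)
Lemma card_col_cell w i0 (Q L : nat) (k : {ffun 'I_n -> 'I_L}) c rho :
  w i0 = Q%:Z -> (0 < L)%N -> (2 * L <= P)%N -> (4 * L <= Q)%N -> rho <= 1 / 4 ->
  Q%:R <= rho * P%:R ->
  (P%:R / (2 * L%:R)) ^+ n * rho <=
  #|[pred x : {ffun 'I_n -> 'I_P} | [forall i, ((x i * L) %/ P == k i)%N] && near_col w c rho x]|%:R.
Proof.
move=> wQ L0 LP LQ r4 QP; have n0 : (0 < n)%N by apply: leq_ltn_trans (ltn_ord i0).
have Lr : 0 < L%:R :> R by rewrite ltr0n.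
have q0 : 0 <= P%:R / (2 * L%:R) :> R by rewrite divr_ge0 // ?mulr_ge0 // ltW.
have r0 : 0 <= rho by rewrite -(pmulr_lge0 _ Pr); apply: le_trans QP.
pose o0 : 'I_P := Ordinal P0.
(* Fibres are indexed by their member with coordinate [i0] equal to 0, whether or not that member
   lies in the cell. *)
pose F (i : 'I_n) : pred 'I_P := if i == i0 then pred1 o0 else [pred y : 'I_P | (y * L) %/ P == k i]%N.
pose B := [pred x : {ffun 'I_n -> 'I_P} | [forall i, F i (x i)]].
pose A := [pred x : {ffun 'I_n -> 'I_P} | [forall i, ((x i * L) %/ P == k i)%N] && near_col w c rho x].
have cB : (P%:R / (2 * L%:R)) ^+ n.-1 <= #|B|%:R :> R.
  rewrite card_forall_ffun (bigD1 i0) //= {1}/F eqxx card1 mul1n natr_prod.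
  have -> : n.-1 = #|predC1 i0| by rewrite cardC1 card_ord.
  rewrite -prodr_const; apply: ler_prod => i; rewrite inE => /negPf ii0; rewrite q0 /F ii0.
  exact: card_cell.
have -> : #|A| = (\sum_(x in A) 1)%N by rewrite sum1_card.
rewrite (partition_big (fun x => upd x i0 o0) B) /=; last first.
  move=> x /andP[/forallP Hx _]; apply/forallP => i; rewrite /F ffunE.
  by case: eqP => //= _; apply: Hx.
rewrite natr_sum.
have -> : (P%:R / (2 * L%:R)) ^+ n * rho = (P%:R / (2 * L%:R)) ^+ n.-1 * (rho * P%:R / (2 * L%:R)).
  by rewrite -{1}(prednK n0) exprSr; ring.
apply: le_trans (_ : #|B|%:R * (rho * P%:R / (2 * L%:R)) <= _).
  by apply: ler_wpM2r => //; rewrite -mulrA mulr_ge0.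
rewrite -[#|B|]sum1_card natr_sum mulr_suml; apply: ler_sum => r Br; rewrite mul1r.
have /forallP Fr := Br; have r00 : r i0 = o0 by have := Fr i0; rewrite /F eqxx => /eqP.
apply: le_trans (card_cell_arc (lin w r) c L0 P0 (ltn_ord (k i0)) LQ r4 QP) _.
rewrite sum1_card ler_nat.
apply: (@leq_card_inj _ _ (fun y => upd r i0 y)) => [y y' _ _ /ffunP/(_ i0)|y /andP[Hy1 Hy2]].
  by rewrite !ffunE eqxx.
apply/andP; split; last first.
  apply/eqP/ffunP => i; rewrite !ffunE; case: eqP => // ->; by rewrite r00.
apply/andP; split.
  apply/forallP => i; rewrite ffunE; have [->//|/negPf ii0] := eqVneq i i0.
  by have := Fr i; rewrite /F ii0.
by rewrite /near_col lin_upd wQ r00 subr0 addrC.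
Qed.

(** * Matrices, as independent columns *)

Section Matrices.
Variable m : nat.
Implicit Types (C : 'I_m -> R).

Definition near_mat w C rho (x : {ffun 'I_m -> {ffun 'I_n -> 'I_P}}) : bool := [forall j, near_col w (C j) rho (x j)].

Lemma card_mat_single w i0 C rho : ~~ (P %| w i0)%Z -> 1 <= rho * P%:R ->
  #|[pred x : {ffun 'I_m -> {ffun 'I_n -> 'I_P}} | near_mat w C rho x]|%:R <= (3 * rho * P%:R ^+ n) ^+ m.
Proof.
move=> Pw rP; rewrite (@card_forall_ffun _ _ (fun j => [pred y | near_col w (C j) rho y])).
rewrite -[m in X in _ <= X]card_ord; apply: natr_prod_le => j; apply: card_col_single Pw rP.
Qed.

(** The conditions constrain each column separately, so the set is a product over the columns and a
    bound uniform in the centres is raised to the power [m]. *)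
Lemma card_mat_pair w v C rho C' rho' (B : R) :
  (forall c c', #|[pred x | near_col w c rho x && near_col v c' rho' x]|%:R <= B) ->
  #|[pred x : {ffun 'I_m -> {ffun 'I_n -> 'I_P}} | near_mat w C rho x && near_mat v C' rho' x]|%:R <= B ^+ m.
Proof.
move=> H; rewrite (eq_card (B := [pred x : {ffun 'I_m -> {ffun 'I_n -> 'I_P}} | [forall j,
   [pred y | near_col w (C j) rho y && near_col v (C' j) rho' y] (x j)]])); last first.
  move=> x; rewrite !inE; apply/andP/forallP => [[/forallP a /forallP b] j /=|H0].
    by rewrite a b.
  by split; apply/forallP => j; have /andP[] := H0 j.
rewrite (@card_forall_ffun _ _ (fun j => [pred y | near_col w (C j) rho y && near_col v (C' j) rho' y])).
rewrite -[m in X in _ <= X]card_ord; apply: natr_prod_le => j; exact: H.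
Qed.

Definition incell (L : nat) (k : {ffun 'I_m -> {ffun 'I_n -> 'I_L}})
  (x : {ffun 'I_m -> {ffun 'I_n -> 'I_P}}) : bool :=
  [forall j, [forall i, ((x j i * L) %/ P == k j i)%N]].

Lemma card_mat_cell w i0 (Q L : nat) (k : {ffun 'I_m -> {ffun 'I_n -> 'I_L}}) C rho :
  w i0 = Q%:Z -> (0 < L)%N -> (2 * L <= P)%N -> (4 * L <= Q)%N -> rho <= 1 / 4 ->
  Q%:R <= rho * P%:R ->
  ((P%:R / (2 * L%:R)) ^+ n * rho) ^+ m <=
  #|[pred x : {ffun 'I_m -> {ffun 'I_n -> 'I_P}} | incell k x && near_mat w C rho x]|%:R.
Proof.
move=> wQ L0 LP LQ r4 QP.
rewrite (eq_card (B := [pred x : {ffun 'I_m -> {ffun 'I_n -> 'I_P}} | [forall j, [pred y : {ffun 'I_n -> 'I_P} |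
   [forall i, ((y i * L) %/ P == k j i)%N] && near_col w (C j) rho y] (x j)]])); last first.
  move=> x; rewrite !inE; apply/andP/forallP => [[/forallP a /forallP b] j /=|H0].
    by rewrite a b.
  by split; apply/forallP => j; have /andP[] := H0 j.
have r0 : 0 <= rho by rewrite -(pmulr_lge0 _ Pr); apply: le_trans QP.
rewrite (@card_forall_ffun _ _ (fun j => [pred y : {ffun 'I_n -> 'I_P} |
   [forall i, ((y i * L) %/ P == k j i)%N] && near_col w (C j) rho y])).
rewrite -[m in X in X <= _]card_ord; apply: natr_prod_ge => [|j].
  by rewrite mulr_ge0 // exprn_ge0 // divr_ge0 // ?mulr_ge0 ?ler0n // ltW.
exact: (card_col_cell _ _ wQ).
Qed.

End Matrices.
End RealCounts.
End LinearForms.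

(** * Second moment *)

Lemma natr_card_sum (R : pzSemiRingType) (T : finType) (A : pred T) :
  #|A|%:R = \sum_x (A x)%:R :> R.
Proof.
rewrite -sum1_card natr_sum big_mkcond /=; apply: eq_bigr => x _.
by rewrite -topredE /=; case: (A x).
Qed.

(** With Z counting the events that hold at x, the first moment of Z on U is carried by the set V
    where Z is nonzero, and the Cauchy-Schwarz inequality bounds the size of V from below. *)
Lemma second_moment_card (R : realFieldType) (T Om : finType) (I : pred T)
  (E : T -> pred Om) (U : pred Om) (a b S : R) : 0 <= a -> 0 < b -> 0 < S ->
  a * S <= \sum_(q | I q) #|[pred x | U x && E q x]|%:R ->
  \sum_(q | I q) \sum_(q' | I q') #|[pred x | E q x && E q' x]|%:R <= b * S ^+ 2 ->
  a ^+ 2 / b <= #|[pred x | U x && [exists q, I q && E q x]]|%:R.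
Proof.
move=> a0 b0 S0 HU HP; set V := [pred x | _].
have [->|an0] := eqVneq a 0; first by rewrite expr0n /= mul0r.
have {}a0 : 0 < a by rewrite lt_def an0.
pose Z x : R := \sum_(q | I q) (E q x)%:R.
have Z0 x : 0 <= Z x by apply: sumr_ge0 => q _; rewrite ler0n.
have H1 : a * S <= \sum_(x | V x) Z x.
  apply: le_trans HU _; rewrite /Z exchange_big /=; apply: ler_sum => q Iq.
  rewrite natr_card_sum big_mkcond [X in _ <= X]big_mkcond /=; apply: ler_sum => x _.
  case Ux : (U x) => //=; case near_grid : (E q x); last by case: ifP.
  by rewrite ifT //; apply/existsP; exists q; rewrite Iq.
have H2 : \sum_(x | V x) Z x ^+ 2 <= b * S ^+ 2.
  apply: le_trans HP.
  apply: le_trans (_ : \sum_x Z x ^+ 2 <= _).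
    by rewrite big_mkcond /=; apply: ler_sum => x _; case: ifP => // _; rewrite exprn_ge0.
  rewrite le_eqVlt; apply/orP; left; apply/eqP.
  transitivity (\sum_x \sum_(q | I q) \sum_(q' | I q') (E q x && E q' x)%:R : R).
    apply: eq_bigr => x _; rewrite expr2 /Z mulr_suml; apply: eq_bigr => q _.
    by rewrite mulr_sumr; apply: eq_bigr => q' _; case: (E q x); rewrite ?mul1r ?mul0r.
  rewrite exchange_big /=; apply: eq_bigr => q _.
  by rewrite exchange_big /=; apply: eq_bigr => q' _; rewrite natr_card_sum.
(* Cauchy-Schwarz appears as the nonnegativity of the sum of (Z - lam)^2 over V; [lam] is the
   quotient of the moment bounds b S^2 and a S. *)
pose lam := b / a * S.
have lam0 : 0 < lam by rewrite mulr_gt0 ?divr_gt0.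
have H3 : 0 <= \sum_(x | V x) (Z x - lam) ^+ 2 by apply: sumr_ge0 => x _; rewrite sqr_ge0.
have H4 : \sum_(x | V x) (Z x - lam) ^+ 2 =
   \sum_(x | V x) Z x ^+ 2 - 2 * lam * \sum_(x | V x) Z x + lam ^+ 2 * #|V|%:R.
  rewrite -sum1_card natr_sum !mulr_sumr -sumrB -big_split /=.
  by apply: eq_bigr => x _; ring.
have H5 : 2 * lam * (a * S) <= 2 * lam * \sum_(x | V x) Z x.
  by rewrite ler_pM2l // mulr_gt0.
have H6 : b * S ^+ 2 <= lam ^+ 2 * #|V|%:R.
  have e : 2 * lam * (a * S) = 2 * (b * S ^+ 2) by rewrite /lam; field.
  by move: H2 H3 H4 H5 e; clear; lra.
have l2 : 0 < lam ^+ 2 by rewrite exprn_gt0.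
rewrite -(ler_pM2l l2); apply: le_trans H6.
rewrite /lam le_eqVlt; apply/orP; left; apply/eqP; field.
by rewrite an0 gt_eqF.
Qed.

Lemma exprD_le (R : realDomainType) (a b : R) m : 0 <= a -> 0 <= b ->
  (a + b) ^+ m <= 2 ^+ m * (a ^+ m + b ^+ m).
Proof.
move=> a0 b0; have [ab|ba] := leP a b.
  apply: le_trans (_ : (2 * b) ^+ m <= _); first by apply: lerXn2r; rewrite ?nnegrE; lra.
  by rewrite exprMn ler_pM2l ?exprn_gt0 // lerDr exprn_ge0.
apply: le_trans (_ : (2 * a) ^+ m <= _); first by apply: lerXn2r; rewrite ?nnegrE; lra.
by rewrite exprMn ler_pM2l ?exprn_gt0 // lerDl exprn_ge0.
Qed.

Lemma card_multiples (N Q e : nat) : (0 < e)%N ->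
  (#|[pred y : 'I_N | (0 < y)%N && (y <= Q)%N && (e %| y)%N]| <= Q %/ e)%N.
Proof.
move=> e0; rewrite -[(Q %/ e)%N]card_ord; case: N => [|N].
  by rewrite (@eq_card0 _ [pred y : 'I_0 | _]) // => -[].
apply: (@leq_card_surj _ _ (fun k : 'I_(Q %/ e) => inord (k.+1 * e) : 'I_N.+1)) => y.
case/andP=> /andP[y0 yQ] ey; have ye : (0 < y %/ e)%N by rewrite divn_gt0 // dvdn_leq.
have lt : ((y %/ e).-1 < Q %/ e)%N by rewrite prednK // leq_div2r.
by exists (Ordinal lt); rewrite /= prednK // divnK // inord_val.
Qed.

Lemma card_pos_le (N Q : nat) : (Q < N)%N ->
  #|[pred y : 'I_N | (0 < y)%N && (y <= Q)%N]| = Q.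
Proof.
move=> QN; apply/eqP; rewrite eqn_leq; apply/andP; split.
  have := @card_multiples N Q 1 isT; rewrite divn1; apply: leq_trans.
  by apply/subset_leq_card/fintype.subsetP => y; rewrite !inE dvd1n andbT.
rewrite -[X in (X <= _)%N]card_ord.
have lt (k : 'I_Q) : (k.+1 < N)%N by apply: leq_ltn_trans QN.
apply: (@leq_card_inj _ _ (fun k => Ordinal (lt k))) => [k k' _ _ [] /val_inj //|k _] /=.
exact: ltn_ord.
Qed.

Lemma sum_inv_sq (R : realFieldType) (K : nat) :
  \sum_(e < K) (e.+1%:R ^- 2 : R) <= 2.
Proof.
(* The induction telescopes: 1 / (k + 1)^2 <= 1 / k - 1 / (k + 1). *)
suff H : \sum_(e < K.+1) (e.+1%:R ^- 2 : R) <= 2 - K.+1%:R^-1.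
  apply: le_trans (_ : \sum_(e < K.+1) (e.+1%:R ^- 2 : R) <= _).
    by rewrite big_ord_recr /= lerDl invr_ge0 exprn_ge0 ?ler0n.
  by apply: le_trans H _; rewrite lerBlDr lerDl invr_ge0 ler0n.
elim: K => [|K IH]; first by rewrite big_ord1 /= expr1n !invr1; lra.
rewrite big_ord_recr /=; apply: le_trans (lerD IH (lexx _)) _.
have k0 : 0 < K.+1%:R :> R by rewrite ltr0n.
rewrite -[K.+2%:R]natr1; move: (K.+1%:R : R) k0 => k k0 {IH}.
have k1 : 0 < k + 1 by lra.
rewrite -subr_ge0.
have -> : 2 - (k + 1)^-1 - (2 - k^-1 + (k + 1) ^- 2) = (k * (k + 1) ^+ 2)^-1.
  by field; rewrite gt_eqF //= gt_eqF.
by rewrite invr_ge0 mulr_ge0 ?exprn_ge0 // ltW.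
Qed.

(* Among the fractions Q / Q' in lowest terms, each denominator e occurs at most
   e times. *)
Lemma sum_denominators (R : realFieldType) (N Q' k : nat) : (2 < k)%N -> (Q' < N)%N ->
  \sum_(Q < N | (0 < Q)%N && (Q <= Q')%N) (Q' %/ gcdn Q Q')%:R ^- k <= 2 :> R.
Proof.
move=> k3 QN; pose e (Q : nat) := (Q' %/ gcdn Q Q')%N.
case: N QN => // N QN.
have eE (Q : nat) : (0 < Q)%N -> (Q <= Q')%N ->
   [/\ (0 < e Q)%N, (e Q <= Q')%N, (Q %/ gcdn Q Q' <= e Q)%N & (0 < Q %/ gcdn Q Q')%N].
  move=> Q0 QQ; have g0 : (0 < gcdn Q Q')%N by rewrite gcdn_gt0 Q0.
  have Q'0 := leq_trans Q0 QQ.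
  split; first by rewrite divn_gt0 // dvdn_leq // dvdn_gcdr.
  - by rewrite leq_div.
  - by rewrite leq_div2r.
  - by rewrite divn_gt0 // dvdn_leq // dvdn_gcdl.
apply: le_trans (sum_inv_sq R N).
rewrite (partition_big (fun Q : 'I_N.+1 => inord (e Q) : 'I_N.+1)
  (fun d : 'I_N.+1 => (0 < d)%N)) /=; last first.
  move=> Q /andP[Q0 QQ]; have [e0 eQ _ _] := eE _ Q0 QQ.
  by rewrite inordK // (leq_ltn_trans eQ).
rewrite big_mkcond big_ord_recl /= add0r; apply: ler_sum => d _.
set D := lift ord0 d.
have DE : (D : nat) = d.+1 by rewrite /D lift0.
rewrite (eq_bigr (fun=> d.+1%:R ^- k)); last first.
  move=> Q /andP[/andP[Q0 QQ] /eqP /(congr1 (@nat_of_ord _))].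
  have [e0 eQ _ _] := eE _ Q0 QQ; rewrite inordK ?(leq_ltn_trans eQ) //.
  by rewrite DE /e => ->.
rewrite sumr_const.
set A := (X in #|X|).
(* With Q' / gcd equal to d + 1, Q is s Q' / (d + 1) for a numerator s between 1 and d + 1. *)
have cA : (#|A| <= d.+1)%N.
  rewrite -[X in (_ <= X)%N]card_ord.
  apply: (@leq_card_surj _ _ (fun s : 'I_d.+1 => inord (s.+1 * (Q' %/ d.+1)) : 'I_N.+1)) => Q.
  case/andP=> /andP[Q0 QQ] /eqP /(congr1 (@nat_of_ord _)).
  have [e0 eQ se s0] := eE _ Q0 QQ; rewrite inordK ?(leq_ltn_trans eQ) // DE => eD.
  have lt : ((Q %/ gcdn Q Q').-1 < d.+1)%N by rewrite prednK // -eD.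
  exists (Ordinal lt); rewrite /= prednK //.
  have -> : (Q' %/ d.+1 = gcdn Q Q')%N.
    rewrite -eD -[X in (X %/ _)%N](divnK (dvdn_gcdr Q Q')) -/(e Q) mulKn //.
  by rewrite divnK ?dvdn_gcdl // inord_val.
have d0 : 0 < d.+1%:R :> R by rewrite ltr0n.
have d1 : 1 <= d.+1%:R :> R by rewrite ler1n.
rewrite -[X in X <= _]mulr_natr; apply: le_trans (_ : d.+1%:R ^- k * d.+1%:R <= _).
  by rewrite ler_pM2l ?invr_gt0 ?exprn_gt0 // ler_nat.
move: (d.+1%:R : R) d0 d1 => t t0 t1.
have -> : t ^- 2 = t ^- 3 * t by field; rewrite gt_eqF.
by rewrite ler_pM2r // lef_pV2 ?posrE ?exprn_gt0 // ler_weXn2l.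
Qed.

Section SecondMoment.
Variables (R : realType) (n m N N' P : nat) (rho : nat -> R) (C : nat -> 'I_m -> R).
Hypothesis nm3 : (2 < n + m)%N.
Hypothesis m0 : (0 < m)%N.
Hypothesis N0 : (0 < N)%N.
Hypothesis Pprime : prime P.
Hypothesis NP : (N' * N' <= P)%N.
Hypothesis rho0 : forall Q, 0 <= rho Q.
Hypothesis rho4 : forall Q, rho Q <= 1 / 4.
Hypothesis rhoP : forall Q, (Q < N')%N -> 0 < rho Q -> Q%:R <= rho Q * P%:R.

Let P0 : (0 < P)%N := prime_gt0 Pprime.
Local Notation Qtype := {ffun 'I_n.+1 -> 'I_N'}.
Implicit Types (q : Qtype) (x : {ffun 'I_m -> {ffun 'I_n.+1 -> 'I_P}}).

Definition intvec q (i : 'I_n.+1) : int := (q i : nat)%:Z.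

(** The first coordinate is the sup-norm and the other n range over 1, ..., Q. Levels of radius zero
    are left out: they add nothing to the moments, and the counts require Q <= rho P. *)
Definition posvec : pred Qtype := [pred q : Qtype |
  [&& (N <= q ord0)%N, 0 < rho (q ord0) & [forall i, (0 < q i)%N && (q i <= q ord0)%N]]].

Lemma posvecP q : posvec q -> [/\ (N <= q ord0)%N, (0 < q ord0)%N, 0 < rho (q ord0) &
  forall i, (0 < q i)%N && (q i <= q ord0)%N].
Proof. by move=> /and3P[a b /forallP c]; split=> //; apply: leq_trans a. Qed.

Definition near_grid q x : bool := near_mat (intvec q) (C (q ord0)) (rho (q ord0)) x.

Let S : R := \sum_(q | posvec q) rho (q ord0) ^+ m.

Lemma sum_posvec : S = \sum_(Q < N' | (N <= Q)%N) Q%:R ^+ n * rho Q ^+ m.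
Proof.
rewrite /S (partition_big (fun q : Qtype => q ord0) (fun Q => (N <= Q)%N)) /=; last first.
  by move=> q /posvecP[].
apply: eq_bigr => Q NQ.
rewrite (eq_bigr (fun=> rho Q ^+ m)) => [|q /andP[_ /eqP -> //]].
have [rQ|rQ] := ltP 0 (rho Q); last first.
  have -> : rho Q = 0 by apply/eqP; rewrite eq_le rQ rho0.
  rewrite expr0n (gtn_eqF m0) mulr0 big1 //.
rewrite sumr_const -[LHS]mulr_natl; congr (_ * _).
pose F (i : 'I_n.+1) : pred 'I_N' :=
  if i == ord0 then pred1 Q else [pred y : 'I_N' | (0 < y)%N && (y <= Q)%N].
rewrite (eq_card (B := [pred q : Qtype | [forall i, F i (q i)]])); last first.
  move=> q; rewrite !inE; apply/andP/forallP => [[/posvecP[_ _ _ H] /eqP E] i|H].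
    by rewrite /F; case: eqP => [->|_] /=; rewrite -?E //; apply: H.
  have qQ : q ord0 = Q by have := H ord0; rewrite /F eqxx => /eqP.
  split; last by rewrite qQ.
  apply/and3P; split; rewrite ?qQ //; apply/forallP => i.
  have := H i; rewrite /F; case: eqP => // -> _; rewrite qQ leqnn andbT.
  exact: leq_trans N0 NQ.
rewrite card_forall_ffun big_ord_recl {1}/F eqxx card1 mul1n.
rewrite (eq_bigr (fun=> (Q : nat))) => [|i _]; last first.
  by rewrite /F /= card_pos_le.
by rewrite prod_nat_const card_ord natrX.
Qed.

(** Only the minors with the first coordinate are tested; as that coordinate is positive on
    [posvec], this is proportionality. *)
Definition parallel q q' : bool := [forall i, (q ord0 * q' i == q' ord0 * q i)%N].
Definition reduced_den (Q Q' : nat) : nat := (Q' %/ gcdn Q Q')%N.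

(** A nonzero minor makes the two events quasi-independent. Otherwise q = s z and q' = e z with s /
    e in lowest terms, and the excess of [card_col_par] appears. *)
Lemma pair_le q q' : posvec q -> posvec q' -> (q ord0 <= q' ord0)%N ->
  #|[pred x | near_grid q x && near_grid q' x]|%:R <=
  48 ^+ m * ((rho (q ord0) * rho (q' ord0)) ^+ m +
     (parallel q q')%:R * (rho (q' ord0) / (reduced_den (q ord0) (q' ord0))%:R) ^+ m) * (P%:R ^+ n.+1) ^+ m.
Proof.
move=> Iq Iq' qq; have [_ Q0 rQ HQ] := posvecP Iq; have [_ Q'0 rQ' HQ'] := posvecP Iq'.
have QP := rhoP (ltn_ord (q ord0)) rQ; have Q'P := rhoP (ltn_ord (q' ord0)) rQ'.
have Q1 : 1 <= (q ord0 : nat)%:R :> R by rewrite ler1n.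
have Q'1 : 1 <= (q' ord0 : nat)%:R :> R by rewrite ler1n.
have W0 : 0 < (P%:R ^+ n.+1) ^+ m :> R by rewrite !exprn_gt0 // ltr0n.
have rr0 : 0 <= rho (q ord0) * rho (q' ord0) by rewrite mulr_ge0.
case par_ : (parallel q q'); last first.
  rewrite mul0r addr0.
  move/negbT: par_; rewrite negb_forall => /existsP[i1 Hi].
  (* The entries are below [N'] and [N' * N' <= P], so a minor that is nonzero over the integers
     stays nonzero modulo [P]. *)
  have PD : ~~ (P %| intvec q ord0 * intvec q' i1 - intvec q i1 * intvec q' ord0)%Z.
    have b1 : (q ord0 * q' i1 < P)%N.
      by apply: leq_trans NP; rewrite ltn_mul ?ltn_ord.
    have b2 : (q i1 * q' ord0 < P)%N.
      by apply: leq_trans NP; rewrite ltn_mul ?ltn_ord.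
    rewrite /intvec -!PoszM -eqz_mod_dvd !modz_small ?ltz_nat //.
    by rewrite eqz_nat [X in _ != X]mulnC.
  apply: le_trans (_ : (9 * (rho (q ord0) * rho (q' ord0)) * P%:R ^+ n.+1) ^+ m <= _).
    by apply: card_mat_pair => c c'; exact: (@card_col_indep P n.+1 Pprime R (intvec q) (intvec q') ord0 i1
      c _ c' _ PD (le_trans Q1 QP) (le_trans Q'1 Q'P)).
  rewrite exprMn ler_pM2r // exprMn ler_wpM2r ?exprn_ge0 //.
  by apply: lerXn2r; rewrite ?nnegrE; lra.
rewrite mul1r; set e := reduced_den _ _; set g := gcdn (q ord0) (q' ord0).
have g0 : (0 < g)%N by rewrite gcdn_gt0 Q0.
have gq : (g %| q ord0)%N by rewrite dvdn_gcdl.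
have gq' : (g %| q' ord0)%N by rewrite dvdn_gcdr.
pose s := (q ord0 %/ g)%N.
have qE : (q ord0 : nat) = (s * g)%N by rewrite divnK.
have q'E : (q' ord0 : nat) = (e * g)%N by rewrite /e /reduced_den divnK.
have s0 : (0 < s)%N by rewrite divn_gt0 // dvdn_leq.
have se : (s <= e)%N by rewrite leq_div2r.
have e0 : (0 < e)%N by apply: leq_trans se.
have cop : coprime s e.
  have : (gcdn (s * g) (e * g) = 1 * g)%N by rewrite -qE -q'E mul1n.
  by rewrite -muln_gcdl => /eqP; rewrite eqn_pmul2r.
have sq' i : (s * q' i = e * q i)%N.
  have /forallP/(_ i)/eqP := par_; rewrite {1}qE {1}q'E => H.
  by apply/eqP; rewrite -(eqn_pmul2l g0) !mulnA ![(g * _)%N]mulnC; apply/eqP.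
(* From s q'_i = e q_i with s and e coprime; this makes [z] integral. *)
have eq' i : (e %| q' i)%N.
  by rewrite -(Gauss_dvdr _ (n := s)) ?sq' ?dvdn_mulr // coprime_sym.
pose z (i : 'I_n.+1) : int := (q' i %/ e)%N%:Z.
have vz i : intvec q' i = e%:Z * z i by rewrite /intvec /z -PoszM mulnC divnK.
have wz i : intvec q i = s%:Z * z i.
  rewrite /intvec /z -PoszM; congr Posz; apply/eqP; rewrite -(eqn_pmul2l e0) -sq'.
  by rewrite mulnCA [(e * (_ %/ _))%N]mulnC divnK.
have Pz : ~~ (P %| z ord0)%Z.
  rewrite /z q'E mulKn // dvdzE /= gtnNdvd //.
  apply: leq_ltn_trans (dvdn_leq Q0 gq) _; apply: leq_trans (ltn_ord _) _.
  apply: leq_trans NP; rewrite leq_pmulr //; exact: leq_ltn_trans (ltn_ord (q ord0)).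
have er : 0 < e%:R :> R by rewrite ltr0n.
have y0 : 0 <= rho (q' ord0) / e%:R by rewrite divr_ge0 // ltW.
have sP : s%:R <= rho (q ord0) * P%:R.
  by apply: le_trans QP; rewrite ler_nat qE leq_pmulr.
have eP : e%:R <= rho (q' ord0) * P%:R.
  by apply: le_trans Q'P; rewrite ler_nat q'E leq_pmulr.
apply: le_trans (_ : ((24 * (rho (q ord0) * rho (q' ord0)) +
   6 * (rho (q' ord0) / e%:R)) * P%:R ^+ n.+1) ^+ m <= _).
  by apply: card_mat_pair => c c'; exact: (@card_col_par P n.+1 Pprime R (intvec q) (intvec q') z ord0 s e
    c _ c' _ wz vz Pz s0 se cop (rho4 _) (rho4 _) sP eP).
rewrite exprMn ler_pM2r //.
apply: le_trans (_ : (24 * (rho (q ord0) * rho (q' ord0) + rho (q' ord0) / e%:R)) ^+ m <= _).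
  by apply: lerXn2r; rewrite ?nnegrE; lra.
(* The 24 comes from the two-arc count, the 2 from splitting the power of a sum by [exprD_le]. *)
rewrite (_ : 48 = 24 * 2) //; last by ring.
rewrite [(24 * (_ + _)) ^+ m]exprMn [(24 * 2) ^+ m]exprMn -mulrA ler_pM2l ?exprn_gt0 //.
exact: exprD_le.
Qed.

(** Given the two norms, q' determines q by proportionality, and each of the n remaining entries of
    q' is a multiple of e between 1 and Q'. *)
Lemma card_par_pairs (Q Q' : 'I_N') : (0 < Q)%N -> (Q <= Q')%N ->
  (#|[pred p : Qtype * Qtype | [&& posvec p.1, posvec p.2, parallel p.1 p.2, p.1 ord0 == Q & p.2 ord0 == Q']]|
   <= (Q' %/ reduced_den Q Q') ^ n)%N.
Proof.
move=> Q0 QQ; set e := reduced_den Q Q'; set g := gcdn Q Q'.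
have Q'0 : (0 < Q')%N by apply: leq_trans QQ.
have g0 : (0 < g)%N by rewrite gcdn_gt0 Q0.
have QE : (Q : nat) = (Q %/ g * g)%N by rewrite divnK // dvdn_gcdl.
have Q'E : (Q' : nat) = (e * g)%N by rewrite /e /reduced_den divnK // dvdn_gcdr.
have e0 : (0 < e)%N by move: Q'0; rewrite Q'E muln_gt0 => /andP[].
have cop : coprime e (Q %/ g).
  have : (gcdn (e * g) (Q %/ g * g) = 1 * g)%N by rewrite -QE -Q'E mul1n gcdnC.
  by rewrite -muln_gcdl => /eqP; rewrite eqn_pmul2r.
pose F (i : 'I_n.+1) : pred 'I_N' :=
  if i == ord0 then pred1 Q' else [pred y : 'I_N' | (0 < y)%N && (y <= Q')%N && (e %| y)%N].
apply: leq_trans (_ : #|[pred q : Qtype | [forall i, F i (q i)]]| <= _)%N; last first.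
  rewrite card_forall_ffun big_ord_recl {1}/F eqxx card1 mul1n.
  apply: leq_trans (_ : \prod_(i < n) (Q' %/ e) <= _)%N.
    by apply: leq_prod => i _; rewrite /F /=; apply: card_multiples.
  by rewrite prod_nat_const card_ord.
apply: (@leq_card_inj _ _ snd) => [[q q'] [r r'] /and5P[_ _ /= /forallP p1 /eqP a1 /eqP a2]
   /and5P[_ _ /= /forallP p2 /eqP b1 /eqP b2] /= E|[q q'] /and5P[/= Iq Iq' /forallP p /eqP a /eqP b]].
  rewrite -E in p2 b2 *; congr pair; apply/ffunP => i; apply/val_inj/eqP.
  rewrite -(eqn_pmul2l Q'0) /= -{1}a2 -(eqP (p1 i)) a1.
  by rewrite -{1}b2 -(eqP (p2 i)) b1.
apply/forallP => i /=; rewrite /F; case: eqP => [->|_] /=; first by rewrite b.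
have [_ _ _ H] := posvecP Iq'; have := H i; rewrite b => -> /=.
have := p i; rewrite a b {1}QE {1}Q'E => /eqP H1.
rewrite -(Gauss_dvdr _ cop); apply/dvdnP; exists (q i); apply/eqP.
rewrite -(eqn_pmul2l g0); apply/eqP; move: H1.
by move: (Q %/ g)%N (nat_of_ord (q' i)) (nat_of_ord (q i)); clear => w u v; lia.
Qed.

(** For fixed norms Q <= Q', there are at most (Q' / e)^n pairs, of total excess at most Q'^n
    rho(Q')^m e^(-(n+m)). Summing over Q gives at most twice the first-moment term of Q', by
    [sum_denominators], whose exponent condition is [2 < n + m]. *)
Lemma sum_par : \sum_(q | posvec q) \sum_(q' | posvec q' && (q ord0 <= q' ord0)%N)
   (parallel q q')%:R * (rho (q' ord0) / (reduced_den (q ord0) (q' ord0))%:R) ^+ m <= 2 * S.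
Proof.
pose f (Q Q' : nat) : R := (rho Q' / (reduced_den Q Q')%:R) ^+ m.
have f0 Q Q' : 0 <= f Q Q' by rewrite exprn_ge0 // divr_ge0 ?ler0n.
rewrite pair_big_dep /=.
apply: le_trans (_ : \sum_(p : Qtype * Qtype | [&& posvec p.1, posvec p.2, parallel p.1 p.2 &
   (p.1 ord0 <= p.2 ord0)%N]) f (p.1 ord0) (p.2 ord0) <= _).
  rewrite big_mkcond [X in _ <= X]big_mkcond /=; apply: ler_sum => -[q q'] _ /=.
  case: (posvec q) => //=; case: (posvec q') => //=; case: (parallel q q') => /=; first by rewrite mul1r.
  by rewrite mul0r; case: ifP.
rewrite (partition_big (fun p : Qtype * Qtype => (p.1 ord0, p.2 ord0))
  (fun t : 'I_N' * 'I_N' => [&& (0 < t.1)%N, (t.1 <= t.2)%N & (N <= t.2)%N])) /=; last first.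
  by move=> [q q'] /= /and4P[/posvecP[_ a _ _] /posvecP[b _ _ _] _ c]; rewrite a b c.
apply: le_trans (_ : \sum_(t : 'I_N' * 'I_N' | [&& (0 < t.1)%N, (t.1 <= t.2)%N & (N <= t.2)%N])
   (t.2 : nat)%:R ^+ n * rho t.2 ^+ m * (reduced_den t.1 t.2)%:R ^- (n + m) <= _).
  apply: ler_sum => -[Q Q'] /= /and3P[Q0 QQ NQ'].
  rewrite (eq_bigr (fun=> f Q Q')) => [|[q q'] /andP[_ /eqP[-> ->]] //].
  rewrite sumr_const -[X in X <= _]mulr_natr.
  apply: le_trans (_ : f Q Q' * (Q' %/ reduced_den Q Q')%N%:R ^+ n <= _).
    apply: ler_wpM2l => //; rewrite -natrX ler_nat.
    apply: leq_trans (card_par_pairs Q0 QQ).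
    apply/subset_leq_card/fintype.subsetP => -[q q']; rewrite !inE /=.
    by case/andP=> /and4P[-> -> -> _] /eqP[-> ->]; rewrite !eqxx.
  have gg : (gcdn Q Q' %| Q')%N by rewrite dvdn_gcdr.
  have g0 : (0 < gcdn Q Q')%N by rewrite gcdn_gt0 Q0.
  have e0 : 0 < (reduced_den Q Q')%:R :> R.
    by rewrite ltr0n divn_gt0 // dvdn_leq // (leq_trans Q0 QQ).
  have -> : (Q' %/ reduced_den Q Q')%N%:R = Q'%:R / (reduced_den Q Q')%:R :> R.
    have H : (Q' %/ reduced_den Q Q' * reduced_den Q Q')%N = Q' by rewrite divnK // -{2}(divnK gg) dvdn_mulr.
    have E : (Q' %/ reduced_den Q Q')%:R * (reduced_den Q Q')%:R = Q'%:R :> R by rewrite -natrM H.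
    by rewrite -E mulfK // gt_eqF.
  rewrite /f !expr_div_n exprD invfM.
  by rewrite le_eqVlt; apply/orP; left; apply/eqP; ring.
rewrite sum_posvec mulr_sumr.
rewrite -(pair_big_dep (fun Q' : 'I_N' => true) (fun (Q Q' : 'I_N') => [&& (0 < Q)%N, (Q <= Q')%N & (N <= Q')%N])
  (fun Q Q' : 'I_N' => (Q' : nat)%:R ^+ n * rho Q' ^+ m * (reduced_den Q Q')%:R ^- (n + m))) /=.
rewrite (exchange_big_dep (fun Q' : 'I_N' => (N <= Q')%N)) /=; last by move=> Q Q' _ /and3P[].
apply: ler_sum => Q' NQ'; rewrite -mulr_sumr mulrC.
apply: ler_wpM2r; first by rewrite mulr_ge0 ?exprn_ge0 ?ler0n.
apply: le_trans (sum_denominators R nm3 (ltn_ord Q')).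
rewrite le_eqVlt; apply/orP; left; apply/eqP; apply: eq_bigl => Q.
by rewrite NQ' andbT.
Qed.

(** The ordered half H of the double sum is at most a constant times S^2 + 2 S, hence times 3 S^2
    because S >= 1. The two halves give the factor 6. *)
Lemma sum_pairs : 1 <= S ->
  \sum_(q | posvec q) \sum_(q' | posvec q') #|[pred x | near_grid q x && near_grid q' x]|%:R <=
  (6 * 48 ^+ m * (P%:R ^+ n.+1) ^+ m) * S ^+ 2.
Proof.
move=> S1; pose W : R := (P%:R ^+ n.+1) ^+ m; rewrite -/W.
pose F q q' : R := #|[pred x | near_grid q x && near_grid q' x]|%:R; rewrite -/(F _ _).
have Fsym q q' : F q q' = F q' q.
  by rewrite /F; congr (_%:R); apply: eq_card => x; rewrite !inE andbC.
have W0 : 0 < W by rewrite !exprn_gt0 // ltr0n.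
pose H : R := \sum_(q | posvec q) \sum_(q' | posvec q' && (q ord0 <= q' ord0)%N) F q q'.
have Hsym : H = \sum_(q | posvec q) \sum_(q' | posvec q' && (q' ord0 <= q ord0)%N) F q q'.
  rewrite /H (exchange_big_dep posvec) /=; last by move=> q q' _ /andP[].
  apply: eq_bigr => q' Iq'; apply: eq_big => [q|q _]; first by rewrite Iq'.
  exact: Fsym.
have H1 : \sum_(q | posvec q) \sum_(q' | posvec q') F q q' <= H + H.
  rewrite [X in _ <= _ + X]Hsym /H -big_split /=; apply: ler_sum => q Iq.
  rewrite [X in _ <= X + _]big_mkcondr [X in _ <= _ + X]big_mkcondr -big_split /=.
  have F0 q' : 0 <= F q q' by rewrite ler0n.
  apply: ler_sum => q' Iq'; have [a|a] := leqP (q ord0) (q' ord0).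
    by rewrite lerDl; case: ifP.
  by rewrite add0r ltnW.
have H2 : H <= 48 ^+ m * (S ^+ 2 + 2 * S) * W.
  apply: le_trans (_ : \sum_(q | posvec q) \sum_(q' | posvec q' && (q ord0 <= q' ord0)%N)
    (48 ^+ m * ((rho (q ord0) * rho (q' ord0)) ^+ m +
     (parallel q q')%:R * (rho (q' ord0) / (reduced_den (q ord0) (q' ord0))%:R) ^+ m) * W) <= _).
    by apply: ler_sum => q Iq; apply: ler_sum => q' /andP[Iq' qq]; apply: pair_le.
  under eq_bigr do rewrite -mulr_suml -mulr_sumr big_split.
  rewrite -mulr_suml -mulr_sumr big_split /=.
  rewrite ler_pM2r // ler_pM2l ?exprn_gt0 //; apply: lerD; last exact: sum_par.
  rewrite expr2 {1}/S mulr_suml; apply: ler_sum => q Iq.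
  rewrite /S mulr_sumr big_mkcondr /=; apply: ler_sum => q' Iq'.
  by case: ifP => _; rewrite ?exprMn // mulr_ge0 ?exprn_ge0.
apply: le_trans H1 _; have k0 : 0 < 48 ^+ m * W by rewrite mulr_gt0 // exprn_gt0.
have : 48 ^+ m * W * (S ^+ 2 + 2 * S) <= 48 ^+ m * W * (3 * S ^+ 2).
  by rewrite ler_pM2l //; nra.
by lra.
Qed.

Lemma union_lower (U : pred {ffun 'I_m -> {ffun 'I_n.+1 -> 'I_P}}) (alpha : R) :
  0 <= alpha -> 1 <= S ->
  (forall q, posvec q -> alpha * rho (q ord0) ^+ m * (P%:R ^+ n.+1) ^+ m <=
     #|[pred x | U x && near_grid q x]|%:R) ->
  alpha ^+ 2 / (6 * 48 ^+ m) * (P%:R ^+ n.+1) ^+ m <=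
  #|[pred x | U x && [exists q, posvec q && near_grid q x]]|%:R.
Proof.
move=> a0 S1 HU; have W0 : 0 < (P%:R ^+ n.+1) ^+ m :> R by rewrite !exprn_gt0 // ltr0n.
have b0 : 0 < 6 * 48 ^+ m * (P%:R ^+ n.+1) ^+ m :> R by rewrite !mulr_gt0 // exprn_gt0.
have := @second_moment_card R _ _ posvec near_grid U (alpha * (P%:R ^+ n.+1) ^+ m) _ S _ b0 _ _ (sum_pairs S1).
rewrite (_ : _ / _ = alpha ^+ 2 / (6 * 48 ^+ m) * (P%:R ^+ n.+1) ^+ m); last first.
  by field; rewrite !gt_eqF ?exprn_gt0 ?ltr0n.
apply; first by rewrite mulr_ge0 // ltW.
  by apply: lt_le_trans S1.
rewrite /S mulr_sumr; apply: ler_sum => q Iq.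
by apply: le_trans (HU q Iq); rewrite mulrAC.
Qed.

(** Distinct cells are disjoint, so their first moments add. The power of 2 divided from [eta] is
    the loss of a factor 2 per coordinate in [card_mat_cell]. *)
Lemma cells_lower (L : nat) (good : pred {ffun 'I_m -> {ffun 'I_n.+1 -> 'I_L}}) (eta : R) :
  (0 < L)%N -> (2 * L <= P)%N -> (4 * L <= N)%N -> 0 <= eta ->
  eta * (L%:R ^+ n.+1) ^+ m <= #|good|%:R -> 1 <= S ->
  (eta / (2 ^+ n.+1) ^+ m) ^+ 2 / (6 * 48 ^+ m) * (P%:R ^+ n.+1) ^+ m <=
  #|[pred x | [exists k, good k && incell k x] && [exists q, posvec q && near_grid q x]]|%:R.
Proof.
move=> L0 LP LN eta0 Hg S1.
have Lr : 0 < L%:R :> R by rewrite ltr0n.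
apply: union_lower => // [|q Iq].
  by rewrite divr_ge0 // !exprn_ge0.
have [NQ Q0 rQ _] := posvecP Iq.
apply: le_trans (_ : \sum_(k | good k) #|[pred x | incell k x && near_grid q x]|%:R <= _).
  apply: le_trans (_ : #|good|%:R * ((P%:R / (2 * L%:R)) ^+ n.+1 * rho (q ord0)) ^+ m <= _).
    apply: le_trans (_ : eta * (L%:R ^+ n.+1) ^+ m *
       ((P%:R / (2 * L%:R)) ^+ n.+1 * rho (q ord0)) ^+ m <= _).
      rewrite le_eqVlt; apply/orP; left; apply/eqP.
      rewrite !exprMn !exprVn !exprMn invfM.
      set l := L%:R ^+ n.+1; set p := P%:R ^+ n.+1; set t := 2 ^+ n.+1; set r := rho _.
      have l0 : l ^+ m != 0 by rewrite gt_eqF // !exprn_gt0.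
      have t0 : t ^+ m != 0 by rewrite gt_eqF // !exprn_gt0.
      by move: (l ^+ m) (t ^+ m) l0 t0 => ? ? ? ?; field; apply/andP.
    apply: ler_wpM2r => //; rewrite exprn_ge0 // mulr_ge0 // exprn_ge0 // divr_ge0 ?ler0n //.
  rewrite -sum1_card natr_sum mulr_suml; apply: ler_sum => k _; rewrite mul1r.
  apply: (card_mat_cell (i0 := ord0) Pprime k (C (q ord0)) (erefl _) L0 LP) => //.
    exact: leq_trans LN NQ.
  exact: rhoP (ltn_ord _) rQ.
rewrite natr_card_sum.
under eq_bigr do rewrite natr_card_sum.
rewrite exchange_big /=; apply: ler_sum => x _.
case Ex : (near_grid q x); last first.
  by rewrite andbF big1 // => k _; rewrite andbF.
rewrite andbT; have [/existsP[k /andP[gk ck]]|/existsPn no] := boolP [exists k, good k && incell k x].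
  rewrite (bigD1 k) //= ck big1 ?addr0 // => k' /andP[gk' kk'].
  rewrite andbT; case ck' : (incell k' x) => //; case/eqP: kk'.
  apply/ffunP => j; apply/ffunP => i; apply/val_inj.
  have /forallP/(_ j)/forallP/(_ i)/eqP E' := ck'.
  by have /forallP/(_ j)/forallP/(_ i)/eqP E := ck; rewrite /= -E' -E.
rewrite big1 // => k gk; rewrite andbT.
by have := no k; rewrite gk /= => /negPf ->.
Qed.

End SecondMoment.

(** * Finitely additive contents *)

Local Open Scope classical_set_scope.

Lemma ultra_fmap (T U : Type) (f : T -> U) (G : set_system T) :
  UltraFilter G -> UltraFilter (f @ G).
Proof.
move=> GU; split=> [|H HF GH]; first exact: fmap_proper_filter.
apply/seteqP; split=> [A HA|A /GH//].
have [//|GA] := in_ultra_setVsetC (f @^-1` A) GU.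
have : H (~` A) by exact: (GH (~` A) GA).
by move=> /(filterI HA); rewrite setICr => /filter_ex[].
Qed.

(** A compact segment contains a limit of every ultrafilter on it; this replaces the extraction of
    subsequences and gives all limits at once. *)
Lemma ultra_cvg_segment (R : realType) (G : set_system nat) (f : nat -> R) (a b : R) :
  UltraFilter G -> (forall k, a <= f k <= b) -> exists p : R, f @ G --> p.
Proof.
move=> GU fab; have := @segment_compact R a b; rewrite compact_ultra.
move=> /(_ (f @ G) (ultra_fmap f GU)) [|p [_ fp]]; last by exists p.
by apply: (@filterE _ G) => k; rewrite /= in_itv /=; exact: fab.
Qed.

Lemma ultra_infty : exists G : set_system nat, UltraFilter G /\ \oo `<=` G.
Proof. exact: ultraFilterLemma. Qed.

Lemma mono_bounded_tail (R : realType) (u : nat -> R) (B e : R) :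
  (forall k, u k <= u k.+1) -> (forall k, u k <= B) -> 0 < e ->
  exists M, forall M', u M' - u M <= e.
Proof.
move=> um uB e0; have hs : has_sup (range u).
  by split; [exists (u 0%N), 0%N | exists B => _ [k _ <-]].
have [_ [M _ <-] Mlt] := sup_adherent e0 hs; exists M => M'.
have : u M' <= sup (range u) by apply: ub_le_sup; [exact: hs.2 | exists M'].
by lra.
Qed.

Section FiniteContent.
Variables (R : realType) (X : Type).

(** Defined on all subsets, so that no measurability question arises; finite additivity is what
    survives a limit of counting densities. *)
Definition content (nu : set X -> R) : Prop :=
  (forall S T, S `&` T = set0 -> nu (S `|` T) = nu S + nu T) /\
  (forall S, 0 <= nu S <= 1).

Lemma content0 nu : content nu -> nu set0 = 0.
Proof.
by move=> [nuU _]; have := nuU set0 set0 (setI0 _); rewrite setU0 => /eqP; rewrite -subr_eq0 opprD addrA subrr add0r oppr_eq0 => /eqP.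
Qed.

Lemma contentD nu S T : content nu -> nu S = nu (S `&` T) + nu (S `\` T).
Proof.
move=> [nuU _]; rewrite -nuU ?setUIDK //.
by rewrite setDE setIACA setICr setI0.
Qed.

Lemma content_le nu S T : content nu -> S `<=` T -> nu S <= nu T.
Proof.
move=> nuC ST; rewrite (contentD T S nuC) (setIidr ST) lerDl.
by have [_ /(_ (T `\` S))/andP[]] := nuC.
Qed.

Lemma contentU_le nu S T : content nu -> nu (S `|` T) <= nu S + nu T.
Proof.
move=> nuC; rewrite (contentD (S `|` T) S nuC) (setIidr (@subsetUl _ S T)) lerD2l.
apply: content_le => //; by rewrite setDUl setDv set0U; apply: subDsetl.
Qed.

Lemma content_bigcup_le nu (F : nat -> set X) (v : nat -> R) (K l : nat) :
  content nu -> (forall k, nu (F k) <= v k) -> (forall k, 0 <= v k) ->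
  nu (\bigcup_(k in [set k | (K <= k < l)%N]) F k) <= \sum_(k < l | (K <= k)%N) v k.
Proof.
move=> nuC Fv v0; elim: l => [|l IH].
  rewrite big_ord0 (_ : \bigcup_(k in _) _ = set0) ?content0 //.
  by apply/seteqP; split => // x [k /=]; rewrite ltn0 andbF.
rewrite big_mkcond big_ord_recr /= -big_mkcond /=.
apply: le_trans (_ : nu ((\bigcup_(k in [set k | (K <= k < l)%N]) F k) `|`
    (if (K <= l)%N then F l else set0)) <= _).
  apply: content_le => // x [k /= /andP[Kk]]; rewrite ltnS leq_eqVlt => /orP[/eqP kl|kl] Fx.
    by right; rewrite -kl Kk.
  by left; exists k => //=; rewrite Kk.
apply: le_trans (contentU_le _ _ nuC) _; apply: lerD => //.
by case: ifP => // _; rewrite content0.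
Qed.

(* Fatou's lemma for a finitely additive content: finite unions almost exhaust
   the tails of the sequence, so finite intersections of them stay large. *)
Lemma content_limsup nu (G : nat -> set X) (W : set X) (d : R) :
  content nu -> 0 < d -> (forall i, d <= nu (W `&` G i)) ->
  exists M : nat -> nat, forall l,
    d / 2 <= nu (W `&` \bigcap_(i in `I_l) \bigcup_(k in [set k | (i <= k < M i)%N]) G k).
Proof.
move=> nuC d0 Gd.
pose u i j := nu (\bigcup_(k in [set k | (i <= k < j)%N]) G k).
(* The errors [e i] sum to at most d / 2, the total loss allowed. *)
pose e i : R := d / 2 * 2 ^- i.+1.
have e0 i : 0 < e i by rewrite mulr_gt0 ?divr_gt0 ?invr_gt0 ?exprn_gt0.
have uS i j : u i j <= u i j.+1.
  by apply: content_le => // x [k /= /andP[ik kj] Gx]; exists k => //=; rewrite ik ltnS ltnW.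
have HM i : exists M, forall M', u i M' - u i M <= e i.
  by apply: (@mono_bounded_tail R (u i) 1) => // k; have [_ /(_ (\bigcup_(k0 in [set k0 | (i <= k0 < k)%N]) G k0))/andP[]] := nuC.
have [M HMM] := choice HM; exists M => l.
pose F i := \bigcup_(k in [set k | (i <= k < M i)%N]) G k.
(* By the choice of [M i], adjoining any later set to the union changes its content by at most
   [e i]. *)
have small i j : (i <= j)%N -> nu (G j `\` F i) <= e i.
  move=> ij; have := HMM i (maxn (M i) j.+1); rewrite /u.
  set B := \bigcup_(k in _) _; rewrite -/(F i) => H.
  have FB : F i `<=` B.
    by move=> x [k /= /andP[ik kM] Gx]; exists k => //=; rewrite ik leq_max kM.
  have := contentD B (F i) nuC; rewrite (setIidr FB) => E.
  apply: le_trans (_ : nu (B `\` F i) <= _); last by lra.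
  apply: content_le => // x [Gx nFx]; split=> //; exists j => //=.
  by rewrite ij leq_max ltnSn orbT.
(* The start is W and [G l], of content at least d; since l is at least every index i used,
   intersecting with [F i] loses at most [e i]. *)
have key p : (p <= l)%N -> d - d / 2 * (1 - 2 ^- p) <=
    nu ((W `&` G l) `&` \bigcap_(i in `I_p) F i).
  elim: p => [|p IH] pl.
    by rewrite II0 bigcap_set0 setIT expr0 invr1 subrr mulr0 subr0.
  have {}IH := IH (ltnW pl).
  have := contentD ((W `&` G l) `&` \bigcap_(i in `I_p) F i) (F p) nuC.
  have le1 : nu (((W `&` G l) `&` \bigcap_(i in `I_p) F i) `\` F p) <= e p.
    apply: le_trans (small p l (ltnW pl)); apply: content_le => //.
    by move=> x [[[_ Gx] _] nF].
  have le2 : nu (((W `&` G l) `&` \bigcap_(i in `I_p) F i) `&` F p) <=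
      nu ((W `&` G l) `&` \bigcap_(i in `I_p.+1) F i).
    apply: content_le => // x [[WG Fi] Fp]; split=> // i /=.
    by rewrite ltnS leq_eqVlt => /orP[/eqP ->//|ip]; apply: Fi.
  have : 2 ^- p = 2 * 2 ^- p.+1 :> R by rewrite exprS; field; rewrite expf_neq0.
  by move: IH le1 le2; rewrite /e => IH le1 le2 E1 E2; nra.
apply: le_trans (_ : nu ((W `&` G l) `&` \bigcap_(i in `I_l) F i) <= _); last first.
  by apply: content_le => // x [[Wx _] Fx].
apply: le_trans (key l (leqnn l)).
have : 0 <= 2 ^- l :> R by rewrite invr_ge0 exprn_ge0.
by nra.
Qed.

(** One ultrafilter finer than the cofinite filter gives a limit for every set simultaneously;
    additivity and eventual bounds pass to the limit. *)
Lemma exists_limit_content (fr : nat -> set X -> R) : (forall k, content (fr k)) ->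
  exists nu, [/\ content nu,
    (forall S b, (\forall k \near \oo, fr k S <= b) -> nu S <= b) &
    (forall S b, (\forall k \near \oo, b <= fr k S) -> b <= nu S)].
Proof.
move=> frC; have [G [GU ooG]] := ultra_infty.
have PG : ProperFilter G := ultra_proper.
have H S : exists p : R, fr ^~ S @ G --> p.
  by apply: (@ultra_cvg_segment R G _ 0 1) => // k; have [_ ->] := frC k.
have [nu Hnu] := choice H; exists nu.
have lo S b : (\forall k \near \oo, b <= fr k S) -> b <= nu S.
  move=> /ooG Gb; rewrite -(cvg_lim _ (Hnu S)) //.
  by apply: limr_ge => //; apply/cvg_ex; exists (nu S).
have hi S b : (\forall k \near \oo, fr k S <= b) -> nu S <= b.
  move=> /ooG Gb; rewrite -(cvg_lim _ (Hnu S)) //.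
  by apply: limr_le => //; apply/cvg_ex; exists (nu S).
split=> //; split=> [S T ST|S].
  apply/esym; apply: (cvg_unique _ _ (Hnu (S `|` T))) => //.
  have -> : fr ^~ (S `|` T) = (fr ^~ S) \+ (fr ^~ T).
    by apply/funext => k /=; have [-> //] := frC k.
  by apply: cvgD; exact: Hnu.
by apply/andP; split; [apply: lo|apply: hi]; apply: nearW => k; have [_ /(_ S)/andP[]] := frC k.
Qed.

End FiniteContent.

(** Continuity at t = 0 of the volume of a widened box, by induction on the factors. *)
Lemma prod_add_le (R : realFieldType) (I : eqType) (s : seq I) (f : I -> R) (e : R) :
  (forall i, 0 <= f i) -> 0 < e ->
  exists2 d, 0 < d & forall t, 0 <= t <= d -> \prod_(i <- s) (f i + t) <= \prod_(i <- s) f i + e.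
Proof.
move=> f0; elim: s e => [|i s IH] e e0.
  by exists 1 => // t _; rewrite !big_nil lerDl ltW.
pose B := \prod_(i <- s) f i.
have B0 : 0 <= B by apply: prodr_ge0.
have A0 := f0 i; set A := f i in A0.
(* Half of [e] pays for A times the error of the other factors, with A + 1 because A may vanish; the
   other half pays for widening A itself. *)
have [|d d0 Hd] := IH (e / (2 * (A + 1))).
  by rewrite divr_gt0 // mulr_gt0 //; lra.
pose e' := e / (2 * (A + 1)).
have e'0 : 0 < e' by rewrite divr_gt0 // mulr_gt0 //; lra.
exists (Num.min d (e / (2 * (B + e')))).
  by rewrite lt_min d0 /= divr_gt0 // mulr_gt0 //; lra.
move=> t /andP[t0]; rewrite le_min => /andP[td te].
rewrite !big_cons -/A -/B.
have Ht := Hd t; rewrite t0 td -/e' -/B in Ht.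
have {}Ht := Ht isT.
apply: le_trans (_ : (A + t) * (B + e') <= _).
  by apply: ler_wpM2l => //; lra.
have be : 0 < B + e' by lra.
have a1 : A * e' <= e / 2.
  have -> : e / 2 = (A + 1) * e' by rewrite /e'; field; rewrite gt_eqF //; lra.
  by rewrite ler_pM2r //; lra.
have a2 : t * (B + e') <= e / 2.
  by rewrite -ler_pdivlMr // -mulrA -invfM.
lra.
Qed.

(** * Boxes and their frequencies on the grid *)

Section Boxes.
Variables (R : realType) (n m : nat).

Lemma card_itv_ord (N : nat) (lo hi : R) : lo <= hi ->
  #|[pred y : 'I_N | (lo <= (y : nat)%:R) && ((y : nat)%:R <= hi)]|%:R <= hi - lo + 1.
Proof.
move=> lh; apply: le_trans (_ : (Num.truncn (hi - lo)).+1%:R <= _); last first.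
  by rewrite -natr1 lerD2r truncn_le subr_ge0.
rewrite ler_nat; case: N => [|N]; first by rewrite eq_card0 // => -[].
rewrite -[X in (_ <= X)%N]card_ord.
apply: (@leq_card_surj _ _ (fun k : 'I_(Num.truncn (hi - lo)).+1 =>
  inord (absz (Num.ceil lo + (k : nat)%:Z)%R) : 'I_N.+1)) => y /andP[ly yh].
have [|| k Hk] := @int_in_itv R lo (hi - lo) (y : nat)%:Z; rewrite -?pmulrn //; first by lra.
by exists k; rewrite -Hk /= inord_val.
Qed.

Definition widevol (a b : 'M[R]_(n, m)) (t : R) : R :=
  \prod_(i < n) \prod_(j < m) (b i j - a i j + t).

Lemma widevol_le (a b : 'M[R]_(n, m)) (e : R) : (forall i j, a i j <= b i j) -> 0 < e ->
  exists2 d, 0 < d & forall t, 0 <= t <= d -> widevol a b t <= mxbox_vol a b + e.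
Proof.
move=> ab e0.
have f0 (p : 'I_n * 'I_m) : 0 <= b p.1 p.2 - a p.1 p.2 by rewrite subr_ge0.
have [d d0 Hd] := @prod_add_le R _ (index_enum ('I_n * 'I_m)%type) _ e f0 e0.
exists d => // t /Hd; rewrite /widevol /mxbox_vol !pair_bigA /=; exact.
Qed.

Lemma card_box (N : nat) (lo hi : 'M[R]_(n, m)) (T : pred {ffun 'I_m -> {ffun 'I_n -> 'I_N}}) :
  (forall i j, lo i j <= hi i j) ->
  (forall x, T x -> forall i j, lo i j <= (x j i : nat)%:R <= hi i j) ->
  #|T|%:R <= widevol lo hi 1.
Proof.
move=> lh HT.
pose F j i := [pred y : 'I_N | (lo i j <= (y : nat)%:R) && ((y : nat)%:R <= hi i j)].
pose B := [pred x : {ffun 'I_m -> {ffun 'I_n -> 'I_N}} | [forall j, [pred z : {ffun 'I_n -> 'I_N} | [forall i, F j i (z i)]] (x j)]].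
apply: le_trans (_ : #|B|%:R <= _).
  rewrite ler_nat; apply/subset_leq_card/fintype.subsetP => x Tx.
  by apply/forallP => j; apply/forallP => i; apply: HT.
rewrite (@card_forall_ffun _ _ (fun j => [pred z : {ffun 'I_n -> 'I_N} | [forall i, F j i (z i)]])).
rewrite /widevol exchange_big natr_prod; apply: ler_prod => j _; rewrite ler0n /=.
rewrite (@card_forall_ffun _ _ (F j)) natr_prod; apply: ler_prod => i _; rewrite ler0n /=.
exact: card_itv_ord.
Qed.

(** Grid points are stored column first, the transpose of the matrix indexing, so that column
    conditions are conditions on the outer function. *)
Definition grid (P : nat) (x : {ffun 'I_m -> {ffun 'I_n -> 'I_P}}) : 'M[R]_(n, m) :=
  \matrix_(i, j) ((x j i : nat)%:R / P%:R).

Definition gridfreq (P : nat) (S : set 'M[R]_(n, m)) : R :=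
  #|[pred x : {ffun 'I_m -> {ffun 'I_n -> 'I_P}} | `[< S (grid x) >]]|%:R / (P%:R ^+ n) ^+ m.

Lemma card_grid (P : nat) : #|{ffun 'I_m -> {ffun 'I_n -> 'I_P}}|%:R = (P%:R ^+ n) ^+ m :> R.
Proof. by rewrite !card_ffun !card_ord !natrX. Qed.

Lemma gridfreq_content P : (0 < P)%N -> content (gridfreq P).
Proof.
move=> P0; have W0 : 0 < (P%:R ^+ n) ^+ m :> R by rewrite !exprn_gt0 // ltr0n.
split=> [S T ST|S].
  rewrite /gridfreq -mulrDl !natr_card_sum -big_split /=; congr (_ / _).
  apply: eq_bigr => x _; rewrite -natrD; congr (_%:R).
  case: (asboolP (S (grid x))) => Sx; case: (asboolP (T (grid x))) => Tx;
    case: (asboolP ((S `|` T) (grid x))) => //= STx.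
  - by have : (S `&` T) (grid x) by []; rewrite ST.
  - by have : (S `&` T) (grid x) by []; rewrite ST.
  - by case: STx; left.
  - by case: STx; right.
  - by case: STx.
rewrite /gridfreq divr_ge0 ?ler0n ?(ltW W0) //= ler_pdivrMr // mul1r.
rewrite -card_grid ler_nat; exact: max_card.
Qed.

Lemma widevol_scale (a b : 'M[R]_(n, m)) (c t : R) :
  widevol (c *: a) (c *: b) (c * t) = (c ^+ n) ^+ m * widevol a b t.
Proof.
rewrite /widevol -exprM.
have -> : c ^+ (n * m) = \prod_(i < n) \prod_(j < m) c by rewrite !prodr_const !card_ord -exprM mulnC.
rewrite -big_split /=; apply: eq_bigr => i _; rewrite -big_split /=; apply: eq_bigr => j _.
by rewrite !mxE -mulrBr -mulrDr.
Qed.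

(** Scaled by P, a side of length l meets at most P l + 1 integers; scaling back widens each side by
    1 / P. *)
Lemma gridfreq_box P (a b : 'M[R]_(n, m)) : (0 < P)%N -> (forall i j, a i j <= b i j) ->
  gridfreq P (mxbox a b) <= widevol a b P%:R^-1.
Proof.
move=> P0 ab; have Pr : 0 < P%:R :> R by rewrite ltr0n.
rewrite /gridfreq ler_pdivrMr ?exprn_gt0 // mulrC -widevol_scale mulfV ?gt_eqF //.
apply: card_box => [i j|x /asboolP Hx i j]; first by rewrite !mxE ler_pM2l.
have := Hx i j; rewrite !mxE ler_pdivlMr // ler_pdivrMr //.
by rewrite ![_ * P%:R]mulrC.
Qed.

End Boxes.

(** * Covers by boxes *)

Lemma sum_half_powers (R : realFieldType) K : \sum_(k < K) (2 ^- k.+1 : R) <= 1.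
Proof.
suff -> : \sum_(k < K) (2 ^- k.+1 : R) = 1 - 2 ^- K by rewrite gerBl invr_ge0 exprn_ge0.
elim: K => [|K IH]; first by rewrite big_ord0 expr0 invr1 subrr.
rewrite big_ord_recr /= IH.
have : 2 ^- K = 2 * 2 ^- K.+1 :> R by rewrite exprS; field; rewrite expf_neq0.
by lra.
Qed.

Lemma finite_uniform (P : nat -> nat -> Prop) (K : nat) :
  (forall k, exists L0, forall L, (L0 <= L)%N -> P k L) ->
  exists L0, forall L k, (L0 <= L)%N -> (k < K)%N -> P k L.
Proof.
move=> /choice[f Hf]; exists (\max_(k < K) f k)%N => L k HL kK; apply: Hf.
by apply: leq_trans HL; exact: (leq_bigmax (Ordinal kK)).
Qed.

Lemma sum_tail_le (R : realDomainType) (v : nat -> R) (K : nat) (e : R) :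
  (forall k, 0 <= v k) -> 0 <= e ->
  (forall K', \sum_(k < K') v k - \sum_(k < K) v k <= e) ->
  forall l, \sum_(k < l | (K <= k)%N) v k <= e.
Proof.
move=> v0 e0 He l; have [lK|Kl] := leqP l K.
  rewrite big1 => [//|k Kk].
  by have := leq_trans (leq_ltn_trans Kk (ltn_ord k)) lK; rewrite ltnn.
apply: le_trans (He l).
rewrite -!(big_mkord xpredT) -(big_mkord (fun k => (K <= k)%N)).
rewrite (big_cat_nat (n := K)) //= ?(ltnW Kl) // [X in X + _]big_nat_cond big1 ?add0r; last first.
  by move=> k /andP[/andP[_ kK] Kk]; move: kK; rewrite ltnNge Kk.
rewrite [X in _ <= X - _](big_cat_nat (n := K)) //= ?(ltnW Kl) // addrAC subrr add0r.
by rewrite big_mkcond; apply: ler_sum => k _; case: ifP.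
Qed.

Definition hits (R : realType) (n m : nat) (c : nat -> 'rV[R]_m) (r : nat -> R)
  (x : 'M[R]_(n, m)) (q : 'rV[int]_n) : Prop :=
  exists p : 'rV[int]_m, Rball (c (supnorm q)) (r (supnorm q))
    ((map_mx intr q) *m x + map_mx intr p).

Section BoxCovers.
Variables (R : realType) (n m : nat).
Implicit Types (a b : nat -> 'M[R]_(n, m)).

(** Each original box ends up in the interior of a larger one, so a limit of points outside the
    larger box is outside the original. Half of the slack 1 - s is spent on the enlargement and half
    remains as [eta]. *)
Lemma enlarge_boxes a b (s : R) : (forall k i j, a k i j <= b k i j) ->
  (forall K, \sum_(k < K) mxbox_vol (a k) (b k) <= s) -> s < 1 ->
  exists a' b' : nat -> 'M[R]_(n, m), exists2 eta : R, 0 < eta &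
    (forall k i j, a' k i j < a k i j /\ b k i j < b' k i j) /\
    (forall K, \sum_(k < K) mxbox_vol (a' k) (b' k) <= 1 - eta).
Proof.
move=> ab Hs s1; pose eta := (1 - s) / 2; have eta0 : 0 < eta by rewrite /eta; lra.
have H k : exists t : R, 0 < t /\ widevol (a k) (b k) t <= mxbox_vol (a k) (b k) + eta * 2 ^- k.+1.
  have [|d d0 Hd] := @widevol_le R n m (a k) (b k) (eta * 2 ^- k.+1) (ab k).
    by rewrite mulr_gt0 // invr_gt0 exprn_gt0.
  by exists d; split=> //; apply: Hd; rewrite lexx ltW.
have [t Ht] := choice H.
exists (fun k => \matrix_(i, j) (a k i j - t k / 2)), (fun k => \matrix_(i, j) (b k i j + t k / 2)).
exists eta => //; split=> [k i j|K].
  by rewrite !mxE; have [t0 _] := Ht k; split; lra.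
apply: le_trans (_ : \sum_(k < K) (mxbox_vol (a k) (b k) + eta * 2 ^- k.+1) <= _).
  apply: ler_sum => k _; apply: le_trans (Ht k).2.
  rewrite le_eqVlt; apply/orP; left; apply/eqP.
  by apply: eq_bigr => i _; apply: eq_bigr => j _; rewrite !mxE; lra.
rewrite big_split /= -mulr_sumr.
have := Hs K; have : eta * \sum_(k < K) (2 ^- k.+1 : R) <= eta * 1.
  by rewrite ler_pM2l // sum_half_powers.
by rewrite /eta; lra.
Qed.

Definition cell (L : nat) (k : {ffun 'I_m -> {ffun 'I_n -> 'I_L}}) : set 'M[R]_(n, m) :=
  [set x | forall i j, (k j i : nat)%:R / L%:R <= x i j < (k j i).+1%:R / L%:R].

(** The lower corner of a touching cell lies in the box extended downwards by 1 / L; counting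
    corners adds another 1 / L per side. *)
Lemma card_touching (L : nat) (a b : 'M[R]_(n, m))
  (T : pred {ffun 'I_m -> {ffun 'I_n -> 'I_L}}) : (0 < L)%N ->
  (forall i j, a i j <= b i j) ->
  (forall k, T k -> exists2 x, cell k x & mxbox a b x) ->
  #|T|%:R <= (L%:R ^+ n) ^+ m * widevol a b (2 / L%:R).
Proof.
move=> L0 ab HT; have Lr : 0 < L%:R :> R by rewrite ltr0n.
have -> : (L%:R ^+ n) ^+ m * widevol a b (2 / L%:R) =
    widevol (\matrix_(i, j) (L%:R * a i j - 1)) (\matrix_(i, j) (L%:R * b i j)) 1.
  rewrite -widevol_scale mulrCA mulfV ?gt_eqF // mulr1.
  by apply: eq_bigr => i _; apply: eq_bigr => j _; rewrite !mxE; lra.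
apply: card_box => [i j|k /HT[x kx bx] i j]; rewrite !mxE.
  have : L%:R * a i j <= L%:R * b i j by rewrite ler_pM2l.
  by lra.
have /andP[] := kx i j; have /andP[] := bx i j.
rewrite ler_pdivrMr // ltr_pdivlMr // -natr1 => ax xb k1 k2.
have : L%:R * a i j <= L%:R * x i j by rewrite ler_pM2l.
have : L%:R * x i j <= L%:R * b i j by rewrite ler_pM2l.
by lra.
Qed.

(** For fine cells, those touching the first K boxes are about as many as the volume predicts. Half
    of [eta] pays for the K errors [e], and the other half bounds the proportion of untouched
    cells. *)
Lemma many_good_cells a b (K : nat) (eta : R) : (forall k i j, a k i j <= b k i j) ->
  0 < eta -> \sum_(k < K) mxbox_vol (a k) (b k) <= 1 - eta ->
  exists2 L, (0 < L)%N & exists2 good : pred {ffun 'I_m -> {ffun 'I_n -> 'I_L}},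
    eta / 2 * (L%:R ^+ n) ^+ m <= #|good|%:R &
    forall k x, good k -> cell k x -> forall l, (l < K)%N -> ~ mxbox (a l) (b l) x.
Proof.
move=> ab eta0 HK; pose e := eta / (2 * K.+1%:R).
have e0 : 0 < e by rewrite divr_gt0 // mulr_gt0.
have [k|L1 HL1] := @finite_uniform (fun k L => (0 < L)%N /\
    widevol (a k) (b k) (2 / L%:R) <= mxbox_vol (a k) (b k) + e) K.
  have [d d0 Hd] := @widevol_le R n m (a k) (b k) e (ab k) e0.
  exists (Num.truncn (2 / d)).+1 => L HL; have L0 : (0 < L)%N by apply: leq_trans HL.
  split=> //; apply: Hd; rewrite divr_ge0 //= ler_pdivrMr ?ltr0n // mulrC -ler_pdivrMr //.
  by apply: le_trans (ltW (truncnS_gt _)) _; rewrite ler_nat.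
pose L := L1.+1; exists L => //.
pose bad l := [pred k : {ffun 'I_m -> {ffun 'I_n -> 'I_L}} | `[< exists2 x, cell k x & mxbox (a l) (b l) x >]].
pose good := [pred k : {ffun 'I_m -> {ffun 'I_n -> 'I_L}} | [forall l : 'I_K, ~~ bad l k]].
exists good; last first.
  move=> k x /forallP gk kx l lK bx; have /negP := gk (Ordinal lK); apply.
  by apply/asboolP; exists x.
have W0 : 0 < (L%:R ^+ n) ^+ m :> R by rewrite !exprn_gt0 // ltr0n.
have Hbad (l : 'I_K) : #|bad l|%:R <= (L%:R ^+ n) ^+ m * (mxbox_vol (a l) (b l) + e).
  have [_ Hl] := HL1 L l (leqnSn _) (ltn_ord l).
  apply: le_trans (_ : (L%:R ^+ n) ^+ m * widevol (a l) (b l) (2 / L%:R) <= _).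
    by apply: card_touching => // k /asboolP.
  by rewrite ler_pM2l.
have tot : (L%:R ^+ n) ^+ m <= #|good|%:R + \sum_(l < K) #|bad l|%:R :> R.
  rewrite -card_grid -[#|{: _}|]/(#|predT|) natr_card_sum.
  rewrite [#|good|%:R]natr_card_sum; under [X in _ <= _ + X]eq_bigr do rewrite natr_card_sum.
  rewrite exchange_big -big_split /=; apply: ler_sum => k _.
  case gk : [forall l : 'I_K, ~~ bad l k]; first by rewrite lerDl sumr_ge0.
  move/negbT: gk; rewrite negb_forall => /existsP[l]; rewrite negbK => bl.
  by rewrite add0r (bigD1 l) //=; move: bl => /= ->; rewrite lerDl sumr_ge0.
have H1 : \sum_(l < K) #|bad l|%:R <= (L%:R ^+ n) ^+ m * (1 - eta / 2) :> R.
  apply: le_trans (ler_sum _ (fun l _ => Hbad l)) _.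
  rewrite -mulr_sumr ler_pM2l // big_split /= sumr_const card_ord -[e *+ K]mulr_natr.
  have : e * K%:R <= eta / 2.
    apply: le_trans (_ : e * K.+1%:R <= _); first by rewrite ler_pM2l // ler_nat.
    have K1 : K.+1%:R != 0 :> R by rewrite pnatr_eq0.
    rewrite /e; move: (K.+1%:R : R) K1 => t t0.
    by rewrite le_eqVlt; apply/orP; left; apply/eqP; field.
  by move: HK; lra.
by move: tot H1; lra.
Qed.

End BoxCovers.

(** * Divergence *)

Section Divergence.
Variables (R : realType) (n m : nat) (c : nat -> 'rV[R]_m) (r : nat -> R).
Hypothesis nm3 : (2 < n + m)%N.
Hypothesis m0 : (0 < m)%N.
Hypothesis r0 : forall Q, 0 <= r Q.

(* Shrinking the radius keeps closed conditions inside the open balls and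
   avoids wrap-around, at the price of a constant in the divergent sum. *)
Definition shrink (Q : nat) : R := Num.min (r Q) (1 / 2) / 2.

Lemma shrink_ge0 Q : 0 <= shrink Q.
Proof. by rewrite divr_ge0 // le_min r0; lra. Qed.

Lemma shrink_le Q : shrink Q <= 1 / 4.
Proof.
have : Num.min (r Q) (1 / 2) <= 1 / 2 by rewrite ge_min lexx orbT.
by rewrite /shrink; lra.
Qed.

Lemma shrink_lt Q : 0 < shrink Q -> shrink Q < r Q.
Proof.
rewrite /shrink; have : Num.min (r Q) (1 / 2) <= r Q by rewrite ge_min lexx.
by lra.
Qed.

Let C (Q : nat) (j : 'I_m) : R := c Q ord0 j.

Definition approx N N' : set 'M[R]_(n.+1, m) :=
  [set x | exists2 q : {ffun 'I_n.+1 -> 'I_N'}, posvec N shrink q &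
     forall j, nearZ (C (q ord0) j) (shrink (q ord0)) (\sum_i (q i : nat)%:R * x i j)].

Lemma near_grid_approx N N' P (q : {ffun 'I_n.+1 -> 'I_N'}) (x : {ffun 'I_m -> {ffun 'I_n.+1 -> 'I_P}}) :
  posvec N shrink q -> near_grid shrink C q x -> approx N N' (grid R x).
Proof.
move=> Iq /forallP Hx; exists q => // j; have := Hx j; rewrite /near_col /lin.
rewrite rmorph_sum /= mulr_suml; congr (is_true (nearZ _ _ _)).
by apply: eq_bigr => i _; rewrite mxE intrM mulrA.
Qed.

Definition cells (L : nat) (good : pred {ffun 'I_m -> {ffun 'I_n.+1 -> 'I_L}}) :
  set 'M[R]_(n.+1, m) := [set x | exists2 k, good k & cell k x].

Lemma incell_grid P L (k : {ffun 'I_m -> {ffun 'I_n.+1 -> 'I_L}}) x : (0 < P)%N -> (0 < L)%N ->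
  incell k x -> cell k (grid R (P := P) x).
Proof.
move=> P0 L0 /forallP kx i j; have /forallP/(_ i)/eqP H := kx j.
have Pr : 0 < P%:R :> R by rewrite ltr0n.
have Lr : 0 < L%:R :> R by rewrite ltr0n.
rewrite mxE ler_pdivlMr // mulrAC ler_pdivrMr // ltr_pdivrMr // mulrAC ltr_pdivlMr //.
rewrite -!natrM ler_nat ltr_nat -H -ltn_divLR // -leq_divRL // leqnn /=.
by rewrite ltnS.
Qed.

(** The bound is independent of [L], [N], [N'] and [P], so it holds for every block of levels and
    survives the limit along primes. *)
Lemma content_approx L (good : pred {ffun 'I_m -> {ffun 'I_n.+1 -> 'I_L}}) (eta : R) N N' :
  (0 < L)%N -> 0 <= eta -> eta * (L%:R ^+ n.+1) ^+ m <= #|good|%:R ->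
  (4 * L <= N)%N ->
  1 <= \sum_(Q < N' | (N <= Q)%N) Q%:R ^+ n * shrink Q ^+ m ->
  exists K, forall P, prime P -> (K <= P)%N ->
    (eta / (2 ^+ n.+1) ^+ m) ^+ 2 / (6 * 48 ^+ m) <= gridfreq P (cells good `&` approx N N').
Proof.
move=> L0 eta0 Hgood LN S1; have N0 : (0 < N)%N by apply: leq_trans LN; rewrite muln_gt0.
(* A prime beyond the sum of these satisfies Q <= shrink(Q) P at every level of positive radius;
   levels of radius zero contribute 0, the value of a division by zero. *)
pose q Q : R := Q%:R / shrink Q.
exists (2 * L + N' * N' + (Num.truncn (\sum_(Q < N') q Q)).+1)%N => P Pp KP.
have P0 := prime_gt0 Pp.
have Pr : 0 < P%:R :> R by rewrite ltr0n.
have q0 Q : 0 <= q Q by rewrite divr_ge0 ?shrink_ge0.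
have rhoP Q : (Q < N')%N -> 0 < shrink Q -> Q%:R <= shrink Q * P%:R.
  move=> QN rQ; rewrite -ler_pdivrMl // mulrC -/(q Q).
  apply: le_trans (_ : \sum_(Q < N') q Q <= _).
    by rewrite (bigD1 (Ordinal QN)) //= lerDl sumr_ge0.
  apply: le_trans (ltW (truncnS_gt _)) _; rewrite ler_nat; apply: leq_trans KP; exact: leq_addl.
have NP : (N' * N' <= P)%N by apply: leq_trans KP; lia.
have LP : (2 * L <= P)%N by apply: leq_trans KP; lia.
have W0 : 0 < (P%:R ^+ n.+1) ^+ m :> R by rewrite !exprn_gt0.
rewrite /gridfreq ler_pdivlMr //.
apply: le_trans (cells_lower C nm3 m0 N0 Pp NP shrink_ge0 shrink_le rhoP L0 LP LN eta0 Hgood _) _.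
  by rewrite (sum_posvec n N' m0 N0 shrink_ge0).
rewrite ler_nat; apply/subset_leq_card/fintype.subsetP => x.
rewrite !inE => /andP[/existsP[k /andP[gk kx]] /existsP[q' /andP[Iq Eqx]]].
split; last exact: near_grid_approx Iq Eqx.
by exists k; [exact: gk | exact: (incell_grid P0 L0 kx)].
Qed.

(** Only finitely many q occur, so finitely many conditions need to be carried to the limit. If x_l
    satisfies one with the shrunk radius, then y, once close enough, satisfies it with the full
    radius, against the hypothesis. *)
Lemma approx_limit N N' (x : nat -> 'M[R]_(n.+1, m)) (y : 'M[R]_(n.+1, m)) (G : set_system nat) :
  (0 < N)%N -> ProperFilter G -> (forall i j, (fun l => x l i j) @ G --> y i j) ->
  (forall q : 'rV[int]_n.+1, (N <= supnorm q)%N -> q != 0 -> ~ hits c r y q) ->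
  \forall l \near G, ~ approx N N' (x l).
Proof.
move=> N0 PG xy nA.
have : \forall l \near G, forall q : {ffun 'I_n.+1 -> 'I_N'}, ~ (posvec N shrink q /\
   forall j, nearZ (C (q ord0) j) (shrink (q ord0)) (\sum_i (q i : nat)%:R * x l i j)).
  apply: filter_forall => q.
  case Iq : (posvec N shrink q); last by apply: nearW => l [].
  have [NQ Q0 rQ Hq] := posvecP N0 Iq.
  pose w : 'rV[int]_n.+1 := \row_i (q i : nat)%:Z.
  have wn : supnorm w = q ord0.
    apply/eqP; rewrite /supnorm eqn_leq; apply/andP; split.
      by apply/bigmax_leqP => i _; rewrite mxE /=; have /andP[] := Hq i.
    by apply: leq_trans (leq_bigmax ord0); rewrite mxE.
  have w0 : w != 0.
    by apply/eqP => /rowP/(_ ord0); rewrite !mxE => -[] q00; rewrite q00 in Q0.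
  have {}nA := nA w; rewrite wn in nA; have {nA} nA := nA NQ w0.
  have e0 : 0 < r (q ord0) - shrink (q ord0) by rewrite subr_gt0 shrink_lt.
  have : \forall l \near G, forall j,
     `|\sum_i (q i : nat)%:R * y i j - \sum_i (q i : nat)%:R * x l i j| < r (q ord0) - shrink (q ord0).
    apply: filter_forall => j.
    have cv : (fun l => \sum_i (q i : nat)%:R * x l i j) @ G --> \sum_i (q i : nat)%:R * y i j.
      apply: cvg_big; [exact: add_continuous | move=> i _].
       apply: cvgMr; exact: xy.
    by move/cvgrPdist_lt : cv; apply.
  apply: filterS => l Hl [_ Hq2]; apply: nA.
  have Hp j : exists p : int, `|\sum_i (q i : nat)%:R * x l i j + p%:~R - C (q ord0) j| <= shrink (q ord0).
    by apply/nearZP; apply: Hq2.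
  have [p Hpp] := choice Hp; exists (\row_j p j) => j.
  rewrite wn !mxE.
  have -> : \sum_k (map_mx intr w) ord0 k * y k j = \sum_i (q i : nat)%:R * y i j :> R.
    by apply: eq_bigr => i _; rewrite !mxE.
  have := Hl j; have := Hpp j; rewrite /C.
  move: (\sum_i (q i : nat)%:R * x l i j) (\sum_i (q i : nat)%:R * y i j) => u v A B.
  have -> : v + (p j)%:~R - c (q ord0) ord0 j = (v - u) + (u + (p j)%:~R - c (q ord0) ord0 j) by ring.
  apply: le_lt_trans (ler_normD _ _) _; lra.
by apply: filterS => l Hl [q Iq Hq]; apply: (Hl q).
Qed.

Hypothesis Hdiv : forall N, exists N',
  1 <= \sum_(Q < N' | (N <= Q)%N) Q%:R ^+ n * shrink Q ^+ m.

(** The point is an ultrafilter limit of points x_l that lie in the good cells and in the first l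
    unions of events, and avoid the first l enlarged boxes. *)
Lemma divergence_point (a b : nat -> 'M[R]_(n.+1, m)) (s : R) :
  (forall k i j, a k i j <= b k i j) ->
  (forall K, \sum_(k < K) mxbox_vol (a k) (b k) <= s) -> s < 1 ->
  exists y, [/\ unit_cube y, (forall k, ~ mxbox (a k) (b k) y) &
    forall N, exists q : 'rV[int]_n.+1, [/\ (N <= supnorm q)%N, q != 0 & hits c r y q]].
Proof.
move=> ab Hs s1.
have [a' [b' [eta eta0 [wide Hs']]]] := enlarge_boxes ab Hs s1.
have ab' k i j : a' k i j <= b' k i j.
  by have [h1 h2] := wide k i j; have := ab k i j; lra.
pose v k := mxbox_vol (a' k) (b' k).
have v0 k : 0 <= v k.
  by apply: prodr_ge0 => i _; apply: prodr_ge0 => j _; rewrite subr_ge0.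
(* This depends on [eta] but not on the number K of boxes removed, so K can be chosen afterwards
   with the remaining volume at most d / 4, below the content d / 2 of the finite intersections. *)
pose d : R := (eta / 2 / (2 ^+ n.+1) ^+ m) ^+ 2 / (6 * 48 ^+ m).
have d0 : 0 < d.
  by rewrite divr_gt0 ?mulr_gt0 ?exprn_gt0 // !divr_gt0 // !exprn_gt0.
have [K HK] : exists K, forall K', \sum_(k < K') v k - \sum_(k < K) v k <= d / 4.
  apply: (@mono_bounded_tail R (fun K => \sum_(k < K) v k) (1 - eta)) => //.
    by move=> k; rewrite big_ord_recr /= lerDl.
  by rewrite divr_gt0.
have [L L0 [good Hgood goodP]] := many_good_cells ab' eta0 (Hs' K).
pose W := cells good.
have [N' HN'] := choice Hdiv.
(* Levels start at 4 L, as required for the events to be well distributed inside cells of side 1 /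
   L. *)
pose G i := approx (4 * L + i) (N' (4 * L + i)%N).
have prP k : exists P, prime P /\ (k < P)%N by have [P kP pP] := prime_above k; exists P.
have [pr Hpr] := choice prP.
have pr0 k : (0 < pr k)%N by have [/prime_gt0] := Hpr k.
have [nu [nuC nule nuge]] := exists_limit_content
  (fun k => @gridfreq_content R n.+1 m (pr k) (pr0 k)).
have HG i : d <= nu (W `&` G i).
  apply: nuge.
  have e20 : 0 <= eta / 2 by rewrite divr_ge0 // ltW.
  have [K0 HK0] := content_approx L0 e20 Hgood (leq_addr i (4 * L)) (HN' (4 * L + i)%N).
  exists K0 => // k /= Kk; apply: HK0; first by have [] := Hpr k.
  by apply: leq_trans Kk _; have [_ /ltnW] := Hpr k.
have [M HM] := content_limsup nuC d0 HG.
have nubox k : nu (mxbox (a' k) (b' k)) <= v k.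
  apply/ler_addgt0Pr => e e0; apply: nule.
  have [t t0 Ht] := widevol_le (ab' k) e0.
  exists (Num.truncn (t^-1)).+1 => // l /= Hl; apply: le_trans (gridfreq_box _ (ab' k)) _ => //.
  apply: Ht; rewrite invr_ge0 ler0n /= -[t]invrK lef_pV2 ?posrE ?invr_gt0 ?ltr0n //.
  apply: le_trans (ltW (truncnS_gt _)) _; rewrite ler_nat; apply: leq_trans Hl _.
  by have [_ /ltnW] := Hpr l.
pose F i := \bigcup_(k in [set k | (i <= k < M i)%N]) G k.
have Hx l : exists x, [/\ W x, (forall i, (i < l)%N -> F i x) &
    forall k, (k < l)%N -> ~ mxbox (a' k) (b' k) x].
  pose T := W `&` \bigcap_(i in `I_l) F i.
  pose B := \bigcup_(k in [set k | (K <= k < l)%N]) mxbox (a' k) (b' k).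
  have nuT : d / 2 <= nu T := HM l.
  have nuB : nu B <= d / 4.
    apply: le_trans (content_bigcup_le K l nuC nubox v0) _.
    by apply: sum_tail_le => //; lra.
  have nTB : 0 < nu (T `\` B).
    have := contentD T B nuC; have : nu (T `&` B) <= nu B by apply: content_le.
    by lra.
  have [x [[Wx Fx] nBx]] : (T `\` B) !=set0.
    by apply/set0P/eqP => TB0; move: nTB; rewrite TB0 content0 // ltxx.
  exists x; split=> // k kl.
  (* The first K boxes are avoided by the choice of good cells, the later ones by removing B. *)
  have [kK|Kk] := ltnP k K.
    by have [z gz zx] := Wx; apply: goodP gz zx _ kK.
  by move=> bx; apply: nBx; exists k => //=; rewrite Kk.
have [x {}Hx] := choice Hx.
have [U [UU ooU]] := ultra_infty.
have PU : ProperFilter U := ultra_proper.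
have x01 l i j : 0 <= x l i j <= 1.
  have [[k _ /(_ i j)/andP[h1 h2]] _ _] := Hx l.
  apply/andP; split; first by apply: le_trans h1; rewrite divr_ge0.
  apply: le_trans (ltW h2) _; rewrite ler_pdivrMr ?ltr0n // mul1r ler_nat.
  exact: ltn_ord.
have Hy i : exists yi : 'I_m -> R, forall j, (fun l => x l i j) @ U --> yi j.
  have Hij j : exists z : R, (fun l => x l i j) @ U --> z.
    by apply: (@ultra_cvg_segment R U _ 0 1 UU) => l.
  by have [yi Hyi] := choice Hij; exists yi.
have [y0 Hy0] := choice Hy.
pose y : 'M[R]_(n.+1, m) := \matrix_(i, j) y0 i j.
have xy i j : (fun l => x l i j) @ U --> y i j by rewrite mxE.
exists y; split.
- move=> i j; rewrite -(cvg_lim _ (xy i j)) //.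
  have cv : cvg ((fun l => x l i j) @ U) by apply/cvg_ex; exists (y i j).
  by apply/andP; split; [apply: limr_ge | apply: limr_le] => //; apply: nearW => l;
    have /andP[] := x01 l i j.
- move=> k bk.
  have H : \forall l \near U, forall i j, a' k i j <= x l i j <= b' k i j.
    apply: filter_forall => i; apply: filter_forall => j.
    have [h1 h2] := wide k i j; have /andP[h3 h4] := bk i j.
    have e0 : 0 < Num.min (y i j - a' k i j) (b' k i j - y i j).
      by rewrite lt_min; apply/andP; split; lra.
    move/cvgrPdist_lt : (xy i j) => /(_ _ e0); apply: filterS => l.
    rewrite lt_min !ltr_norml => /andP[/andP[h5 h6] /andP[h7 h8]].
    by apply/andP; split; lra.
  have H2 : \forall l \near U, (k < l)%N by apply: ooU; exists k.+1.
  have [l [Hl kl]] := filter_ex (filterI H H2).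
  by have [_ _ /(_ k kl)] := Hx l; apply.
(* For l > N, x_l lies in some [G i] with N <= i < [M N]. This window does not depend on l, so
   finitely many applications of [approx_limit] contradict it along [U]. *)
- move=> N; apply: contrapT => nN.
  have H : \forall l \near U, forall i : 'I_(M N), ~ ((N <= i)%N /\ G i (x l)).
    apply: filter_forall => i.
    have [Ni|iN] := leqP N i; last by apply: nearW => l [].
    have := @approx_limit (4 * L + i) (N' (4 * L + i)%N) x y U.
    move=> H; have {}H : \forall l \near U, ~ G i (x l).
      apply: H => // [|q qN q0 Aq].
        by rewrite addn_gt0 muln_gt0 L0.
      apply: nN; exists q; split=> //; apply: leq_trans qN; apply: leq_trans Ni _.
      exact: leq_addl.
    by apply: filterS H => l nG [].
  have H2 : \forall l \near U, (N < l)%N by apply: ooU; exists N.+1.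
  have [l [Hl Nl]] := filter_ex (filterI H H2).
  have [_ /(_ N Nl)[i /= /andP[Ni iM] Gi] _] := Hx l.
  by apply: (Hl (Ordinal iM)).
Qed.

End Divergence.

(** * Convergence *)

Section OuterMeasure.
Variables (R : realType) (n m : nat).
Local Notation mx := 'M[R]_(n, m).

Lemma mxbox_vol_ge0 (a b : mx) : (forall i j, a i j <= b i j) -> 0 <= mxbox_vol a b.
Proof.
by move=> ab; apply: prodr_ge0 => i _; apply: prodr_ge0 => j _; rewrite subr_ge0.
Qed.

Lemma leb_outer_ge0 (A : set mx) : (0 <= leb_outer A)%E.
Proof.
apply: le_ereal_inf_tmp => s [a [b [ab _ ->]]].
by apply: nneseries_ge0 => k _ _; rewrite lee_fin mxbox_vol_ge0.
Qed.

(** Degenerate boxes pad finite lists to sequences at no cost; positive dimensions matter, an empty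
    product being 1. *)
Lemma vol_point : (0 < n)%N -> (0 < m)%N -> mxbox_vol (0 : mx) 0 = 0.
Proof.
move=> n0 m0; rewrite /mxbox_vol (bigD1 (Ordinal n0)) //= (bigD1 (Ordinal m0)) //=.
by rewrite subrr !mul0r.
Qed.

Lemma sum_nth_le (T : eqType) (x0 : T) (s : seq T) (F : T -> R) M :
  (forall x, x \in s -> 0 <= F x) -> F x0 = 0 ->
  \sum_(i < M) F (nth x0 s i) <= \sum_(x <- s) F x.
Proof.
move=> + Fx0; elim: s M => [|x s IH] M Fs.
  by rewrite big_nil big1 // => i _; rewrite nth_nil.
case: M => [|M]; first by rewrite big_ord0 big_seq sumr_ge0.
rewrite big_ord_recl /= big_cons lerD2l; apply: IH => y ys.
by apply: Fs; rewrite inE ys orbT.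
Qed.

(** Reindexes a doubly indexed cover by the pairing code of (Q, i); numbers that code no pair
    receive the degenerate box. *)
Lemma leb_outer_le (A : set mx) (f : nat -> nat -> mx * mx) (w : nat -> R) (e : R) :
  (0 < n)%N -> (0 < m)%N ->
  (forall Q i k j, (f Q i).1 k j <= (f Q i).2 k j) ->
  (forall x, A x -> exists Q i, mxbox (f Q i).1 (f Q i).2 x) ->
  (forall Q M, \sum_(i < M) mxbox_vol (f Q i).1 (f Q i).2 <= w Q) ->
  (forall M, \sum_(Q < M) w Q <= e) ->
  (leb_outer A <= e%:E)%E.
Proof.
move=> n0 m0 ff fA fw we.
pose g k : mx * mx := oapp (fun p : nat * nat => f p.1 p.2) (0, 0) (pickle_inv k).
pose V (p : mx * mx) : R := mxbox_vol p.1 p.2.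
have gg k i j : (g k).1 i j <= (g k).2 i j.
  by rewrite /g; case: (pickle_inv k) => [p|] //=.
have V0 Q i : 0 <= V (f Q i) by apply: mxbox_vol_ge0.
apply: ge_ereal_inf; exists (\sum_(0 <= k <oo) (V (g k))%:E)%E.
  exists (fun k => (g k).1), (fun k => (g k).2); split=> // x Ax.
  have [Q [i bx]] := fA x Ax; exists (pickle (Q, i)) => //.
  by rewrite /g pickleK_inv.
apply: lime_le; first by apply: is_cvg_nneseries => k _ _; rewrite lee_fin mxbox_vol_ge0.
apply: nearW => K; rewrite sumEFin lee_fin big_mkord.
(* All pairs coded below K lie in the square of side M, and each pair has one code, so the partial
   sum is at most the sum over the square. *)
pose M := (\max_(k < K) oapp (fun p : nat * nat => maxn p.1 p.2) 0 (pickle_inv k)).+1%N.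
apply: le_trans (we M).
apply: le_trans (_ : \sum_(Q < M) \sum_(i < M) V (f Q i) <= _); last first.
  by apply: ler_sum => Q _; apply: fw.
apply: le_trans (_ : \sum_(k < K) \sum_(Q < M) \sum_(i < M)
    (if (k : nat) == pickle ((Q : nat), (i : nat)) then V (f Q i) else 0) <= _).
  apply: ler_sum => k _.
  have nn (Q i : nat) : 0 <= (if (k : nat) == pickle (Q, i) then V (f Q i) else 0).
    by case: ifP.
  rewrite /g; case E : (pickle_inv k) => [[Q i]|] /=; last first.
    rewrite [X in X <= _]vol_point //; apply: sumr_ge0 => Q _; apply: sumr_ge0 => i _; exact: nn.
  have Hmax : (maxn Q i < M)%N.
    rewrite ltnS; apply: leq_trans (leq_bigmax k); by rewrite E.
  have QM : (Q < M)%N by apply: leq_ltn_trans Hmax; rewrite leq_maxl.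
  have iM : (i < M)%N by apply: leq_ltn_trans Hmax; rewrite leq_maxr.
  have kE : (k : nat) == pickle (Q, i).
    by have := @pickle_invK (nat * nat)%type k; rewrite E /= => ->.
  rewrite (bigD1 (Ordinal QM)) //= (bigD1 (Ordinal iM)) //= kE -addrA lerDl.
  by rewrite addr_ge0 //; apply: sumr_ge0 => Q' _; [apply: nn | apply: sumr_ge0 => i' _; apply: nn].
rewrite exchange_big; apply: ler_sum => Q _ /=.
rewrite exchange_big; apply: ler_sum => i _ /=.
rewrite -big_mkcond /= sumr_const -[X in X <= _]mulr_natr ler_piMr // -[1]/(1%:R) ler_nat.
rewrite -[X in (_ <= X)%N](card_ord 1).
by apply: (@leq_card_in _ _ (fun=> ord0)) => k k' /eqP kE /eqP k'E _; apply/val_inj; rewrite /= kE k'E.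
Qed.

End OuterMeasure.

Lemma finite_supnorm_lt (n N : nat) : finite_set [set q : 'rV[int]_n | (supnorm q < N)%N].
Proof.
pose g (u : {ffun 'I_n -> 'I_(2 * N).+1}) : 'rV[int]_n := \row_i ((u i : nat)%:Z - N%:Z).
apply: (@sub_finite_set _ _ [set` [seq g u | u <- enum {: {ffun 'I_n -> 'I_(2 * N).+1}}]]); last exact: finite_seq.
move=> q /= qN; apply/mapP; exists [ffun i => inord (absz (q ord0 i + N%:Z))].
  by rewrite mem_enum.
apply/rowP => i; rewrite mxE ffunE.
have : (`|q ord0 i| < N)%N by apply: leq_ltn_trans qN; rewrite /supnorm (leq_bigmax i).
by move: (q ord0 i) => z zN; rewrite inordK; lia.
Qed.

Section Convergence.
Variables (R : realType) (n m : nat) (c : nat -> 'rV[R]_m) (r : nat -> R).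
Hypothesis n0 : (0 < n)%N.
Hypothesis m0 : (0 < m)%N.
Local Notation mx := 'M[R]_(n, m).

(** The first factor bounds the encodings of vectors of norm Q through 2 n (2 Q + 1)^(n-1) <= 2 n (3
    Q)^(n-1). The 6 is the 3 of [card_arc] times the doubling of the radius. *)
Definition level_const : R := (2 * n * 3 ^ n.-1)%N%:R * 6 ^+ m.

(* Redundant encoding of the vectors of sup-norm Q: a coordinate equal to Q or
   -Q, its sign, and the other coordinates shifted by Q. *)
Definition signed_vec (Q : nat) (t : 'I_n * bool * {ffun 'I_n -> 'I_(2 * Q).+1}) (i : 'I_n) : int :=
  if i == t.1.1 then (if t.1.2 then Q%:Z else - Q%:Z) else (t.2 i : nat)%:Z - Q%:Z.

Lemma signed_vec_surj (q : 'rV[int]_n) (Q : nat) : supnorm q = Q ->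
  exists t : 'I_n * bool * {ffun 'I_n -> 'I_(2 * Q).+1},
  t.2 t.1.1 = ord0 /\ forall i, signed_vec t i = q ord0 i.
Proof.
move=> QE.
have qQ i : (`|q ord0 i| <= Q)%N by rewrite -QE /supnorm (leq_bigmax i).
have [i0 Hi0] : exists i0, Q = `|q ord0 i0|%N.
  have [i0 H] := @bigop.eq_bigmax 'I_n (fun i => `|q ord0 i|%N) (eq_ind_r (leq 1) n0 (card_ord n)).
  by exists i0; rewrite -QE.
exists (i0, 0 <= q ord0 i0, [ffun i => if i == i0 then ord0 else inord (absz (q ord0 i + Q%:Z))]).
split=> [|i]; first by rewrite ffunE eqxx.
rewrite /signed_vec /= ffunE; have [->|ii0] := eqVneq i i0.
  by rewrite Hi0; case: (leP 0 (q ord0 i0)) => h; lia.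
have := qQ i; move: (q ord0 i) => z zQ.
by rewrite inordK; lia.
Qed.

(** Moving x to the lower corner of its grid cube changes q x by at most n Q / P <= r(Q) in each
    coordinate, so that the corner meets the condition with radius 2 r(Q); such corners are counted
    by [card_mat_single]. *)
Lemma cover_level (Q : nat) : (0 < Q)%N -> 0 <= r Q -> exists s : seq (mx * mx),
  [/\ forall p, p \in s -> forall i j, p.1 i j <= p.2 i j,
      \sum_(p <- s) mxbox_vol p.1 p.2 <= level_const * (Q%:R ^+ n.-1 * r Q ^+ m) &
      forall x q, unit_cube x -> supnorm q = Q -> hits c r x q ->
        exists2 p, p \in s & mxbox p.1 p.2 x].
Proof.
move=> Q0; rewrite le_eqVlt => /orP[/eqP r0|r0].
  exists [::]; split=> //.
    by rewrite big_nil -r0 expr0n (gtn_eqF m0) !mulr0.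
  move=> x q _ qQ [p]; rewrite /Rball qQ -r0 => /(_ (Ordinal m0)).
  by rewrite ltNge normr_ge0.
(* The summands force n Q <= r(Q) P for the move to the corner, 1 <= r(Q) P for the arc count, and Q
   < P so that P does not divide the coordinate of absolute value Q. *)
pose B : R := (n * Q)%:R / r Q + 1 / r Q + Q%:R.
have [P BP Pp] := prime_above (Num.truncn B).+1.
have P0 := prime_gt0 Pp; have Pr : 0 < P%:R :> R by rewrite ltr0n.
have {}BP : B <= P%:R.
  by apply: le_trans (ltW (truncnS_gt _)) _; rewrite ler_nat ltnW.
have p1 : 0 <= (n * Q)%:R / r Q by rewrite divr_ge0 // ltW.
have p2 : 0 <= 1 / r Q by rewrite divr_ge0 // ltW.
have p3 : 0 <= Q%:R :> R by [].
have nQP : (n * Q)%:R <= r Q * P%:R.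
  by rewrite -ler_pdivrMl // mulrC; move: BP; rewrite /B; lra.
have rP1 : 1 <= r Q * P%:R.
  by rewrite -ler_pdivrMl // mulrC; move: BP; rewrite /B; lra.
have QP : (Q < P)%N.
  have : 0 < 1 / r Q by rewrite divr_gt0.
  by rewrite -(ltr_nat R); move: BP; rewrite /B; lra.
pose I : finType := ('I_n * bool * {ffun 'I_n -> 'I_(2 * Q).+1})%type.
pose Y : finType := {ffun 'I_m -> {ffun 'I_n -> 'I_P}}.
pose T := [pred t : I * Y | (t.1.2 t.1.1.1 == ord0) && near_mat (signed_vec t.1) (fun j => c Q ord0 j) (2 * r Q) t.2].
pose box (t : I * Y) : mx * mx := (grid R t.2, \matrix_(i, j) (grid R t.2 i j + P%:R^-1)).
have W0 : 0 < (P%:R ^+ n) ^+ m :> R by rewrite !exprn_gt0.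
exists [seq box t | t <- enum T]; split.
- move=> p /mapP[t _ ->] i j /=; by rewrite [X in _ <= X]mxE lerDl invr_ge0 ltW.
- rewrite big_map big_enum /=.
  rewrite (eq_bigr (fun=> ((P%:R ^+ n) ^+ m)^-1)); last first.
    move=> t _; rewrite /mxbox_vol /=.
    rewrite (eq_bigr (fun=> (P%:R^-1) ^+ m)); last first.
      move=> i _; rewrite (eq_bigr (fun=> P%:R^-1)); first by rewrite prodr_const card_ord.
      by move=> j _; rewrite mxE addrAC subrr add0r.
    by rewrite prodr_const card_ord -!exprM -exprVn mulnC.
  rewrite sumr_const -[X in X <= _]mulr_natl ler_pdivrMr //.
  pose J := [pred t : I | t.2 t.1.1 == ord0].
  (* The encoded entry at the distinguished coordinate is normalised to 0, leaving n - 1 free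
     entries. *)
  have HJ : (#|J| <= 2 * n * (2 * Q).+1 ^ n.-1)%N.
    have -> : #|J| = (\sum_(p : 'I_n * bool) #|[pred u : {ffun 'I_n -> 'I_(2 * Q).+1} | u p.1 == ord0]|)%N.
      under [RHS]eq_bigr do rewrite -sum1_card.
      by rewrite pair_big_dep -sum1_card; apply: eq_bigl => -[p u].
    rewrite (eq_bigr (fun=> (2 * Q).+1 ^ n.-1)%N).
      by rewrite sum_nat_const card_prod card_ord card_bool [(2 * n)%N]mulnC.
    move=> [i0 b] _ /=.
    pose F (i : 'I_n) : pred 'I_(2 * Q).+1 := if i == i0 then pred1 ord0 else predT.
    rewrite (eq_card (B := [pred u : {ffun 'I_n -> 'I_(2 * Q).+1} | [forall i, F i (u i)]])); last first.
      move=> u; rewrite !inE; apply/idP/forallP => [u0 i|/(_ i0)]; last by rewrite /F eqxx.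
      by rewrite /F; case: eqP => [->|].
    rewrite card_forall_ffun (bigD1 i0) //= {1}/F eqxx card1 mul1n.
    rewrite (eq_bigr (fun=> (2 * Q).+1)) => [|i /negPf ii0]; last by rewrite /F ii0 card_ord.
    by rewrite prod_nat_const cardC1 card_ord.
  have HT : #|T|%:R <= #|J|%:R * (6 * r Q * P%:R ^+ n) ^+ m.
    have -> : #|T| = (\sum_(t | J t) #|[pred y : Y | near_mat (signed_vec t) (fun j => c Q ord0 j) (2 * r Q) y]|)%N.
      under [RHS]eq_bigr do rewrite -sum1_card.
      by rewrite pair_big_dep -sum1_card; apply: eq_bigl => -[t y].
    rewrite natr_sum -[#|J|]sum1_card natr_sum mulr_suml; apply: ler_sum => t Jt; rewrite mul1r.
    have -> : 6 * r Q = 3 * (2 * r Q) by ring.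
    apply: (card_mat_single Pp (i0 := t.1.1)); last by lra.
    rewrite /signed_vec eqxx dvdzE; case: (t.1.2); rewrite ?abszN /= gtnNdvd //.
  apply: le_trans HT _.
  have -> : (6 * r Q * P%:R ^+ n) ^+ m = 6 ^+ m * r Q ^+ m * (P%:R ^+ n) ^+ m by rewrite !exprMn.
  rewrite mulrA ler_pM2r // /level_const mulrA [X in _ <= X](_ : _ =
    ((2 * n * 3 ^ n.-1)%N%:R * Q%:R ^+ n.-1) * 6 ^+ m * r Q ^+ m); last by ring.
  rewrite ler_pM2r ?exprn_gt0 // ler_pM2r ?exprn_gt0 // -natrX -natrM ler_nat.
  apply: leq_trans HJ _; rewrite -[X in (_ <= X)%N]mulnA leq_mul2l; apply/orP; right.
  by rewrite -expnMn; have [->|k0] := posnP n.-1; rewrite ?expn0 // leq_exp2r //; lia.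
- move=> x q x01 qQ [p Hp].
  have [t [t0 Ht]] := signed_vec_surj qQ.
  (* The minimum with P - 1 matters for an entry equal to 1, which is put in the last closed grid
     cube. *)
  have lt (z : R) : (minn (Num.truncn (z * P%:R)) P.-1 < P)%N.
    by rewrite (leq_ltn_trans (geq_minr _ _)) // prednK.
  pose y : Y := [ffun j => [ffun i => Ordinal (lt (x i j))]].
  have ylo i j : grid R y i j <= x i j <= grid R y i j + P%:R^-1.
    rewrite mxE !ffunE /=; have /andP[x0 x1] := x01 i j.
    have xP0 : 0 <= x i j * P%:R by rewrite mulr_ge0 // ltW.
    have /andP[h1 h2] := truncn_itv xP0.
    rewrite -{3}[P%:R^-1]mul1r -mulrDl ler_pdivrMr // ler_pdivlMr // natr1.
    apply/andP; split; first by apply: le_trans h1; rewrite ler_nat geq_minl.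
    have [hh|hh] := leqP (Num.truncn (x i j * P%:R)) P.-1; first exact: ltW.
    by rewrite prednK // -[X in _ <= X]mul1r ler_pM2r.
  exists (box (t, y)); last by move=> i j; rewrite /= [X in _ <= _ <= X]mxE; exact: ylo.
  apply/mapP; exists (t, y) => //; rewrite mem_enum inE /= t0 eqxx /=.
  apply/forallP => j; apply/nearZP; exists (p ord0 j).
  have := Hp j; rewrite qQ !mxE.
  have -> : (lin (signed_vec t) (y j))%:~R / P%:R = \sum_i (q ord0 i)%:~R * grid R y i j :> R.
    rewrite /lin rmorph_sum /= mulr_suml; apply: eq_bigr => i _.
    by rewrite mxE intrM Ht mulrA.
  have -> : \sum_k (map_mx intr q) ord0 k * x k j = \sum_i (q ord0 i)%:~R * x i j :> R.
    by apply: eq_bigr => i _; rewrite mxE.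
  have : `|\sum_i (q ord0 i)%:~R * grid R y i j - \sum_i (q ord0 i)%:~R * x i j| <= r Q :> R.
    rewrite -sumrB; apply: le_trans (ler_norm_sum _ _ _) _.
    apply: le_trans (_ : \sum_(i < n) Q%:R / P%:R <= _); last first.
      by rewrite sumr_const card_ord -[X in X <= _]mulr_natl mulrA ler_pdivrMr // -natrM.
    apply: ler_sum => i _; rewrite -mulrBr normrM; apply: ler_pM => //.
      rewrite -intr_norm -abszE -pmulrn ler_nat -qQ /supnorm; exact: (leq_bigmax i).
    have /andP[h1 h2] := ylo i j; rewrite distrC ger0_norm; last by rewrite subr_ge0.
    by lra.
  move: (\sum_i (q ord0 i)%:~R * grid R y i j) (\sum_i (q ord0 i)%:~R * x i j) => u v H1 H2.
  have -> : u + (p ord0 j)%:~R - c Q ord0 j = (u - v) + (v + (p ord0 j)%:~R - c Q ord0 j) by ring.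
  by apply: le_trans (ler_normD _ _) _; lra.
Qed.

End Convergence.

(** * The series of ball measures and its two cases *)

Section Dichotomy.
Variables (R : realType) (n m : nat) (c : nat -> 'rV[R]_m) (r : nat -> R).
Hypothesis n0 : (0 < n)%N.
Hypothesis m0 : (0 < m)%N.
Hypothesis r0 : forall q, 0 <= r q.

(** The value 0 at q = 0 allows sums over ordinals for a series that starts at 1. *)
Definition term (q : nat) : R :=
  if (0 < q)%N then q%:R ^+ (n - 1) * torus_ball_measure m (r q) else 0.

Lemma torus_ball_measure_ge0 q : 0 <= torus_ball_measure m (r q).
Proof. by rewrite /torus_ball_measure le_min ler01 exprn_ge0 // mulr_ge0. Qed.

Lemma term_ge0 q : 0 <= term q.
Proof.
by rewrite /term; case: ifP => // _; rewrite mulr_ge0 ?exprn_ge0 ?torus_ball_measure_ge0.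
Qed.

Let S : \bar R := (\sum_(1 <= q <oo)
  ((q%:R) ^+ (n - 1) * torus_ball_measure m (r q))%:E)%E.

Lemma series_partial K : (\sum_(1 <= q < K)
    ((q%:R) ^+ (n - 1) * torus_ball_measure m (r q))%:E)%E = (\sum_(q < K) term q)%:E.
Proof.
rewrite sumEFin; congr EFin; case: K => [|K]; first by rewrite big_geq // big_ord0.
rewrite -(big_mkord xpredT) [RHS]big_ltn // {1}/term add0r.
by rewrite !big_nat; apply: eq_bigr => q /andP[q1 _]; rewrite /term q1.
Qed.

Lemma series_lt_pinfty : (S < +oo)%E -> exists B : R, forall K, \sum_(q < K) term q <= B.
Proof.
have t0 q : (1 <= q)%N -> xpredT q ->
    (0 <= (q%:R ^+ (n - 1) * torus_ball_measure m (r q))%:E)%E.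
  by move=> _ _; rewrite lee_fin mulr_ge0 ?exprn_ge0 ?torus_ball_measure_ge0.
move=> Soo; have S0 : (0 <= S)%E by apply: nneseries_ge0.
have Sfin : S \is a fin_num by rewrite ge0_fin_numE.
exists (fine S) => K; rewrite -lee_fin fineK // -series_partial.
exact: nneseries_lim_ge.
Qed.

Lemma series_eq_pinfty (B : R) : S = +oo%E -> exists K, B < \sum_(q < K) term q.
Proof.
move=> Soo; apply: contrapT => /forallNP H.
have : (S <= B%:E)%E.
  apply: lime_le.
    apply: is_cvg_nneseries => q _ _.
    by rewrite lee_fin mulr_ge0 ?exprn_ge0 ?torus_ball_measure_ge0.
  apply: nearW => K; rewrite series_partial lee_fin leNgt; apply/negP; exact: H.
by rewrite Soo.
Qed.

(** Borel-Cantelli: every x of the limsup set is hit at levels beyond any M, so the covers of those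
    levels suffice, and their volume is at most [lc] times a tail of the series. *)
Lemma leb_outer_convergence : (S < +oo)%E -> leb_outer (@A_set R n m c r) = 0%E.
Proof.
move=> /series_lt_pinfty[B HB]; apply/eqP; rewrite eq_le leb_outer_ge0 andbT.
apply/lee_addgt0Pr => eps eps0; rewrite add0e.
pose lc := level_const R n m; have lc0 : 0 <= lc by rewrite mulr_ge0 // exprn_ge0.
(* The bound 1 / 2 keeps the ball measures of the tail below 1, where they equal (2 r)^m; the other
   bound gives lc e <= eps, with lc + 1 to avoid division by zero. *)
pose e : R := Num.min (1 / 2) (eps / (lc + 1)).
have e0 : 0 < e.
  rewrite lt_min; apply/andP; split; first by lra.
  by rewrite divr_gt0 //; lra.
have monoT K : \sum_(q < K) term q <= \sum_(q < K.+1) term q.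
  by rewrite big_ord_recr /= lerDl term_ge0.
have [M HM] := mono_bounded_tail monoT HB e0.
have tail := sum_tail_le term_ge0 (ltW e0) HM.
have rterm Q : (0 < Q)%N -> (M <= Q)%N -> Q%:R ^+ n.-1 * r Q ^+ m <= term Q.
  move=> Q0 MQ; rewrite /term Q0 subn1; have Q1 : 1 <= Q%:R :> R by rewrite ler1n.
  have Qp : 1 <= Q%:R ^+ n.-1 :> R by rewrite exprn_ege1.
  apply: ler_wpM2l; first by rewrite exprn_ge0.
  have : term Q <= e.
    apply: le_trans (tail Q.+1); rewrite (bigD1 ord_max) //= lerDl sumr_ge0 // => k _.
    exact: term_ge0.
  rewrite /term Q0 subn1 => tQ.
  have e2 : e <= 1 / 2 by rewrite ge_min lexx.
  have : torus_ball_measure m (r Q) < 1.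
    apply: le_lt_trans (_ : e < 1); last by lra.
    by apply: le_trans tQ; rewrite ler_peMl // torus_ball_measure_ge0.
  rewrite /torus_ball_measure; have [//|h _] := leP 1 ((2 * r Q) ^+ m).
    by rewrite ltxx.
  by apply: lerXn2r; rewrite ?nnegrE ?mulr_ge0 //; have := r0 Q; lra.
have cov Q : exists s : seq ('M[R]_(n, m) * 'M[R]_(n, m)), (0 < Q)%N ->
  [/\ forall p, p \in s -> forall i j, p.1 i j <= p.2 i j,
      \sum_(p <- s) mxbox_vol p.1 p.2 <= lc * (Q%:R ^+ n.-1 * r Q ^+ m) &
      forall x q, unit_cube x -> supnorm q = Q -> hits c r x q ->
        exists2 p, p \in s & mxbox p.1 p.2 x].
  have [->|Q0] := posnP Q; first by exists [::].
  by have [s Hs] := cover_level c n0 m0 Q0 (r0 Q); exists s.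
have [s Hs] := choice cov.
pose good Q := (0 < Q)%N && (M <= Q)%N.
pose f Q i := if good Q then nth (0, 0) (s Q) i else (0, 0).
have ff Q i k j : (f Q i).1 k j <= (f Q i).2 k j.
  rewrite /f; case: ifP => // /andP[Q0 _]; have [iz|zi] := ltnP i (size (s Q)).
    by have [+ _ _] := Hs Q Q0; apply; apply: mem_nth.
  by rewrite nth_default.
apply: (@leb_outer_le R n m _ f (fun Q => if good Q then lc * term Q else 0)) => //.
- move=> x [x01 inf].
  (* Only finitely many q have norm below [maxn M 1]; the 1 excludes norm zero. *)
  have [q [qn hq]] : exists q : 'rV[int]_n, (maxn M 1 <= supnorm q)%N /\ hits c r x q.
    apply: contrapT => H; apply: inf.
    have fin := @finite_supnorm_lt n (maxn M 1).
    apply: (@sub_finite_set _ _ _ _ fin) => q [_ hq] /=.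
    by rewrite ltnNge; apply/negP => qn; apply: H; exists q.
  move: qn; rewrite geq_max => /andP[Mq q1].
  have [_ _ /(_ x q x01 erefl hq)[p ps bx]] := Hs _ q1.
  exists (supnorm q), (index p (s (supnorm q))).
  by rewrite /f /good q1 Mq nth_index.
- move=> Q K; rewrite /f; case: ifP => [/andP[Q0 MQ]|_]; last first.
    by rewrite big1 // => i _; apply: vol_point.
  have [s1 s2 _] := Hs Q Q0.
  apply: le_trans (_ : \sum_(p <- s Q) mxbox_vol p.1 p.2 <= _).
    apply: (@sum_nth_le R _ (0, 0) (s Q) (fun p => mxbox_vol p.1 p.2) K).
      by move=> p ps; apply: mxbox_vol_ge0; apply: s1.
    exact: vol_point.
  by apply: le_trans s2 _; apply: ler_wpM2l => //; apply: rterm.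
- move=> K; apply: le_trans (_ : lc * e <= _).
    apply: le_trans (_ : lc * \sum_(Q < K | (M <= Q)%N) term Q <= _); last by apply: ler_wpM2l.
    rewrite mulr_sumr [X in _ <= X]big_mkcond; apply: ler_sum => Q _; rewrite /good.
    have h : 0 <= lc * term Q by rewrite mulr_ge0 // term_ge0.
    by case: (0 < Q)%N; case: (M <= Q)%N.
  apply: le_trans (_ : lc * (eps / (lc + 1)) <= _).
    by apply: ler_wpM2l => //; rewrite ge_min lexx orbT.
  rewrite mulrA ler_pdivrMr; last by lra.
  by nra.
Qed.

End Dichotomy.

Lemma leb_outer_le1 (R : realType) (n m : nat) (A : set 'M[R]_(n, m)) :
  (0 < n)%N -> (0 < m)%N -> A `<=` @unit_cube R n m -> (leb_outer A <= 1)%E.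
Proof.
move=> n0 m0 AU; pose one : 'M[R]_(n, m) := const_mx 1.
pose f (Q i : nat) : 'M[R]_(n, m) * 'M[R]_(n, m) :=
  if (Q == 0)%N && (i == 0)%N then (0, one) else (0, 0).
have one1 : mxbox_vol (0 : 'M[R]_(n, m)) one = 1.
  by rewrite /mxbox_vol big1 // => i _; rewrite big1 // => j _; rewrite !mxE subr0.
apply: (@leb_outer_le R n m A f (fun Q => (Q == 0)%N%:R)) => //.
- by move=> Q i k j; rewrite /f; case: ifP => // _ /=; rewrite !mxE ler01.
- move=> x /AU x01; exists 0%N, 0%N => i j; rewrite /f /= !mxE; exact: x01.
- move=> Q [|M]; first by rewrite big_ord0.
  rewrite big_ord_recl big1 ?addr0 => [|i _]; last first.
    by rewrite /f andbF /= vol_point.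
  rewrite /f andbT; case: ifP => _ /=; first by rewrite one1.
  by rewrite vol_point.
- move=> [|M]; first by rewrite big_ord0.
  by rewrite big_ord_recl big1 ?addr0.
Qed.

Lemma leb_outer_divergence (R : realType) (n m : nat) (c : nat -> 'rV[R]_m) (r : nat -> R) :
  (2 < n + m)%N -> (0 < m)%N -> (forall q, 0 <= r q) ->
  (\sum_(1 <= q <oo) ((q%:R) ^+ (n.+1 - 1) * torus_ball_measure m (r q))%:E)%E = +oo%E ->
  leb_outer (@A_set R n.+1 m c r) = 1%E.
Proof.
move=> nm3 m0 r0 Soo; apply/eqP; rewrite eq_le; apply/andP; split.
  by apply: leb_outer_le1 => // x [].
have Hdiv N : exists N', 1 <= \sum_(Q < N' | (N <= Q)%N) Q%:R ^+ n * shrink r Q ^+ m :> R.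
  pose t := term n.+1 m r.
  (* Four times the shrunk radius is min(2 r, 1), whose m-th power is the measure of the ball. *)
  have tle Q : (0 < Q)%N -> t Q <= 4 ^+ m * (Q%:R ^+ n * shrink r Q ^+ m).
    move=> Q0; rewrite /t /term Q0 subn1 mulrCA; apply: ler_wpM2l; first by rewrite exprn_ge0.
    rewrite -exprMn /torus_ball_measure /shrink.
    have [h|h] := leP (r Q) (1 / 2).
      by rewrite (_ : 4 * (r Q / 2) = 2 * r Q); [rewrite ge_min lexx orbT | field].
    by rewrite (_ : 4 * (1 / 2 / 2) = 1); [rewrite expr1n ge_min lexx | field].
  (* Beyond the first N + 1 terms the sum still exceeds 4^m, which is 1 after passing to shrunk
     radii. *)
  have [K HK] := series_eq_pinfty r0 (\sum_(Q < N.+1) t Q + 4 ^+ m) Soo.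
  exists K; have k4 : 0 < 4 ^+ m :> R by rewrite exprn_gt0.
  rewrite -(ler_pM2l k4) mulr1 mulr_sumr.
  apply: le_trans (_ : \sum_(Q < K | (N < Q)%N) t Q <= _); last first.
    rewrite [X in X <= _]big_mkcond [X in _ <= X]big_mkcond; apply: ler_sum => Q _.
    have [NQ|NQ] := ltnP N Q; first by rewrite (ltnW NQ) tle // (leq_ltn_trans _ NQ).
    by case: ifP => // _; rewrite mulr_ge0 ?exprn_ge0 ?mulr_ge0 ?exprn_ge0 ?(shrink_ge0 r0).
  have : \sum_(Q < K) t Q <= \sum_(Q < N.+1) t Q + \sum_(Q < K | (N < Q)%N) t Q.
    rewrite (bigID (fun Q : 'I_K => (N < Q)%N)) /= addrC lerD2r.
    under eq_bigl do rewrite -leqNgt -ltnS.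
    have [KN|NK] := leqP K N.+1.
      rewrite (big_ord_widen_cond N.+1 (fun i => (i < N.+1)%N) t KN) [X in X <= _]big_mkcond.
      by apply: ler_sum => Q _; case: ifP => // _; apply: term_ge0.
    by rewrite [X in _ <= X](big_ord_widen K t (ltnW NK)).
  by move: HK; rewrite -/t; lra.
(* A cover of total volume below 1 would miss the point of [divergence_point], which belongs to the
   set because it is hit at unbounded norms. *)
apply: le_ereal_inf_tmp => s [a [b [ab cov ->]]]; rewrite leNgt; apply/negP => s1.
have v0 k : (0 <= k)%N -> xpredT k -> (0 <= (mxbox_vol (a k) (b k))%:E)%E.
  by move=> _ _; rewrite lee_fin mxbox_vol_ge0.
have sfin : (\sum_(0 <= k <oo) (mxbox_vol (a k) (b k))%:E)%E \is a fin_num.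
  rewrite ge0_fin_numE; first by apply: lt_trans s1 _; rewrite ltry.
  exact: nneseries_ge0.
have [||y [y01 nbox Hy]] := divergence_point c nm3 m0 r0 Hdiv ab
   (s := fine (\sum_(0 <= k <oo) (mxbox_vol (a k) (b k))%:E)%E).
- move=> K; rewrite -lee_fin fineK // -sumEFin -(big_mkord xpredT (fun k => (mxbox_vol (a k) (b k))%:E)).
  exact: nneseries_lim_ge.
- by rewrite -lte_fin fineK.
have [|k _ bk] := cov y; last exact: nbox bk.
split=> // /finite_seqP[t Ht].
have [q [qn q0 hq]] := Hy (\max_(q <- t) supnorm q).+1%N.
have : q \in t by have : [set` t] q by rewrite -Ht.
move=> qt; move: qn; rewrite ltnNge; apply/negP; rewrite negbK.
by rewrite (bigop.leq_bigmax_seq q).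
Qed.

Theorem theorem2 (R : realType) (n m : nat) (hn : (1 <= n)%N) (hm : (1 <= m)%N)
  (hnm : (2 < n * m)%N) (c : nat -> 'rV[R]_m) (r : nat -> R)
  (hr : forall q, 0 <= r q) :
  let S := (\sum_(1 <= q <oo)
              ((q%:R) ^+ (n - 1) * torus_ball_measure m (r q))%:E)%E in
  ((S < +oo)%E -> leb_outer (@A_set R n m c r) = 0%E) /\
  (S = +oo%E -> leb_outer (@A_set R n m c r) = 1%E).
Proof.
split; first exact: leb_outer_convergence.
case: n hn hnm => // n _ hnm; apply: leb_outer_divergence => //.
(* Positive integers with product above 2 have sum at least 4; here the first dimension is [n.+1],
   so [2 < n + m]. *)
by move: hnm hm; nia.
Qed.
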